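(* Let $G=(V,\boldsymbol{W})$ be a weighted directed network with $N=|V|$ nodes, and let $R$, $T$, $D$, $R'$, $D'$, $\widehat{V}$, $\boldsymbol{P}$, $\boldsymbol{\mu}_T$, $\theta_T$, $\beta_T^*$, the PureRank vector $\boldsymbol{\pi}=(\pi_j)_{j\in V}$, the distribution $\boldsymbol{\varpi}$ on $\widehat{V}$ and the stochastic matrix $\boldsymbol{M}$ on $\widehat{V}$ be as defined in the context. Let $\{\widehat{X}_n:n=0,1,2,\dots\}$ be a Markov chain on the state space $\widehat{V}$ with initial distribution $\boldsymbol{\varpi}$ and transition matrix $\boldsymbol{M}$. The following statements hold: (i) Writing $\mathbf{1}(A)$ for the indicator of an event $A$, $$ \pi_j=\begin{cases} \displaystyle\lim_{n\to\infty}\frac1n\sum_{i\in\widehat{V}}[\boldsymbol{\varpi}]_i\,\mathsf{E}\Bigl[\sum_{\nu=0}^{n-1}\mathbf{1}(\widehat{X}_\nu=j)\Bigm|\widehat{X}_0=i\Bigr], & j\in T,\\[2ex] \displaystyle\lim_{n\to\infty}\frac1n\sum_{i\in\widehat{V}}[\boldsymbol{\varpi}]_i\,\mathsf{E}\Bigl[\sum_{\nu=0}^{n-1}\mathbf{1}(\widehat{X}_\nu\in\{j,j'\})\Bigm|\widehat{X}_0=i\Bigr], & j\in R\sqcup D. \end{cases} $$ If $T=\varnothing$, then the first case does not arise, and in the second case $\{j,j'\}$ is to be read as $\{j\}$. (ii) Suppose that $T\neq\varnothing$. Define $$ \tau_T(0)=\inf\{n\ge0:\widehat{X}_n\in T\},\qquad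 \tau_T(m)=\inf\{n>\tau_T(m-1):\widehat{X}_n\in T,\ \widehat{X}_{n-1}\in R'\sqcup D'\},\quad m=1,2,\dots, $$ so that, for each $m\ge0$, $\tau_T(m+1)-1$ is the first hitting time of $R'\sqcup D'$ after time $\tau_T(m)$, and $\{\tau_T(m),\tau_T(m)+1,\dots,\tau_T(m+1)-2\}$ is the $m$th sojourn period in $T$, whose length is $$ C_T(m):=\tau_T(m+1)-\tau_T(m)-1 . $$ Then the sequence $\{C_T(m):m=0,1,2,\dots\}$ is independent and identically distributed given $\widehat{X}_0\in T$, and, for every $m\ge 0$, $$ \mathsf{E}[C_T(m)\mid\widehat{X}_0\in T]=\frac1{\theta_T}=\frac{1}{|T|\beta_T^*}=\boldsymbol{\mu}_T(\boldsymbol{I}-\boldsymbol{P}_T)^{-1}\boldsymbol{e}_T . $$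
   Context: Network: $V=\{1,\dots,N\}$ is the node set, $\boldsymbol{W}=(w_{i,j})_{i,j\in V}$ is a matrix with nonnegative real entries, where $w_{i,j}$ is the weight of the directed link from $i$ to $j$ ($0$ means no link). Let $w_i^{out}=\sum_{j\in V}w_{i,j}$. The normalized weight matrix $\boldsymbol{P}=(p_{i,j})_{i,j\in V}$ has $p_{i,j}=w_{i,j}/w_i^{out}$ if $w_i^{out}>0$ and $p_{i,j}=0$ if $w_i^{out}=0$. For $S,S'\subseteq V$, $\boldsymbol{P}_S=(p_{i,j})_{i,j\in S}$ and $\boldsymbol{P}_{S,S'}=(p_{i,j})_{i\in S,j\in S'}$. $\boldsymbol{e}_S$ is the column vector of ones indexed by $S$, $\boldsymbol{\mu}_S=\boldsymbol{e}_S^{\top}/|S|$, $\boldsymbol{I}_S$ is the identity matrix indexed by $S$, and $[\boldsymbol{v}]_i$ is the $i$th entry of $\boldsymbol{v}$. Node classification: $D=\{i\in V: w_i^{out}=0\}$. A nonempty set $S\subseteq V\setminus D$ is a recurrent class if it is a closed strongly connected component of $G$, i.e. $\sum_{n\ge1}[\boldsymbol{W}^n]_{i,j}>0$ for all $i,j\in S$ and $\sum_{n\ge1}[\boldsymbol{W}^n]_{i,j}=0$ for all $i\in S$, $j\in V\setminus S$. The recurrent classes are $R_1,\dots,R_K$ ($K\ge0$), pairwise disjoint; $R=\bigsqcup_k R_k$; $T=V\setminus(R\sqcup D)$. Any of these may be empty; vectors, blocks, block rows, block columns and terms associated with an empty set are absent (sums over empty sets are zero). Local importance vectors (row vectors):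 $\boldsymbol{\lambda}_D=\boldsymbol{\mu}_D$; $\boldsymbol{\lambda}_{R_k}$ is the unique stationary distribution vector of the irreducible stochastic matrix $\boldsymbol{P}_{R_k}$; $\boldsymbol{\lambda}_T=\dfrac{\boldsymbol{\mu}_T(\boldsymbol{I}-\boldsymbol{P}_T)^{-1}}{\boldsymbol{\mu}_T(\boldsymbol{I}-\boldsymbol{P}_T)^{-1}\boldsymbol{e}_T}$ (the inverse exists). For $T\ne\varnothing$: $\theta_T=\boldsymbol{\lambda}_T\boldsymbol{P}_{T,R}\boldsymbol{e}_R+\boldsymbol{\lambda}_T\boldsymbol{P}_{T,D}\boldsymbol{e}_D=1-\boldsymbol{\lambda}_T\boldsymbol{P}_T\boldsymbol{e}_T$ and $\beta_T^*=\dfrac{1}{\boldsymbol{e}_T^{\top}(\boldsymbol{I}-\boldsymbol{P}_T)^{-1}\boldsymbol{e}_T}$. PureRank vector: $\boldsymbol{\pi}=(\pi_j)_{j\in V}$ has subvectors $$\boldsymbol{\pi}_{R_k}=\tfrac1N\Bigl(|R_k|\boldsymbol{\lambda}_{R_k}+\tfrac{|T|}{1+\theta_T}\boldsymbol{\lambda}_T\boldsymbol{P}_{T,R_k}\Bigr),\quad \boldsymbol{\pi}_D=\tfrac1N\Bigl(|D|\boldsymbol{\mu}_D+\tfrac{|T|}{1+\theta_T}\boldsymbol{\lambda}_T\boldsymbol{P}_{T,D}\Bigr),\quad \boldsymbol{\pi}_T=\tfrac1N\tfrac{|T|}{1+\theta_T}\boldsymbol{\lambda}_T .$$ Extended sets: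 if $T\ne\varnothing$, each $j\in R\sqcup D$ gets a distinct copy $j'$; $R'=\{j':j\in R\}$, $D'=\{j':j\in D\}$, and $\widehat{T}=T\sqcup R'\sqcup D'$. If $T=\varnothing$, then $R'=D'=\widehat{T}=\varnothing$. $\widehat{V}=R\sqcup\widehat{T}\sqcup D$. Transition matrix: with blocks ordered $(R',T,D')$ (rows/columns indexed by $R'$, $D'$ being identified with $R$, $D$ via $j'\leftrightarrow j$), $$\boldsymbol{M}_{\widehat{T}}=\begin{pmatrix}\boldsymbol{O}&\boldsymbol{e}_R\boldsymbol{\mu}_T&\boldsymbol{O}\\ \boldsymbol{P}_{T,R}&\boldsymbol{P}_T&\boldsymbol{P}_{T,D}\\ \boldsymbol{O}&\boldsymbol{e}_D\boldsymbol{\mu}_T&\boldsymbol{O}\end{pmatrix},$$ and $\boldsymbol{M}$ is the stochastic matrix on $\widehat{V}$ that is block diagonal with respect to $R\sqcup\widehat{T}\sqcup D$ with diagonal blocks $\boldsymbol{P}_R$, $\boldsymbol{M}_{\widehat{T}}$, $\boldsymbol{I}_D$. Initial distribution: $\boldsymbol{\varpi}$ is the probability row vector on $\widehat{V}$ with $[\boldsymbol{\varpi}]_i=1/N$ for $i\in R\sqcup T\sqcup D=V$ and $[\boldsymbol{\varpi}]_i=0$ for $i\in R'\sqcup D'$. Conventions: $\mathsf{E}[\,\cdot\mid\widehat{X}_0=i]$ is expectation for the chain started from state $i$ (for $i$ with $[\boldsymbol{\varpi}]_i=0$ the corresponding term is zero); $\inf\varnothing=\infty$; in (ii), identities involving $\tau_T(m)$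 and $C_T(m)$ are understood on the event $\{\widehat{X}_0\in T\}$, up to null sets. *)

(* Defs.v *)
From HB Require Import structures.
From mathcomp Require Import all_boot all_order all_algebra.
From mathcomp Require Import all_classical all_reals all_analysis measurable_realfun.

Set Implicit Arguments.
Unset Strict Implicit.
Unset Printing Implicit Defensive.

Import Order.TTheory GRing.Theory Num.Theory.
Import numFieldNormedType.Exports.

Local Open Scope classical_set_scope.
Local Open Scope ring_scope.

Section Vectors.
Context {R : realType} {N : nat}.

(* Vectors and blocks indexed by S : {set 'I_N} live in dimension #|S|, the
   k-th coordinate being that of the node [enum_val k]; blocks over an empty
   set are thus 0-dimensional and contribute nothing. *)
Definition sub_mx (A : 'M[R]_N) (S S' : {set 'I_N}) : 'M[R]_(#|S|, #|S'|) :=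
  mxsub (fun k : 'I_#|S| => enum_val k) (fun k : 'I_#|S'| => enum_val k) A.

Definition ones (S : {set 'I_N}) : 'cV[R]_#|S| := const_mx 1.

Definition unif (S : {set 'I_N}) : 'rV[R]_#|S| := #|S|%:R^-1 *: (ones S)^T.

(* [v]_j for j in S, and 0 for j outside S (at most one term in the sum). *)
Definition entry (S : {set 'I_N}) (v : 'rV[R]_#|S|) (j : 'I_N) : R :=
  \sum_(k < #|S| | enum_val k == j) v 0 k.

Definition stationary_distribution (n : nat) (A : 'M[R]_n) (l : 'rV[R]_n) :=
  [/\ forall k, 0 <= l 0 k, \sum_k l 0 k = 1 & l *m A = l].

End Vectors.

Section Network.
Context {R : realType} {N : nat} (W : 'M[R]_N).

Definition wout (i : 'I_N) : R := \sum_j W i j.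

Definition Pmx : 'M[R]_N :=
  \matrix_(i, j) (if 0 < wout i then W i j / wout i else 0).

Definition Dset : {set 'I_N} := [set i | wout i == 0]%SET.

(* The series have nonnegative terms and may diverge, hence are taken in
   the extended reals. *)
Definition recurrent_class (S : {set 'I_N}) : Prop :=
  [/\ S != finset.set0, S \subset ~: Dset,
      forall i j, i \in S -> j \in S ->
        (0 < \sum_(1 <= n <oo) ((W ^+ n) i j)%:E)%E
    & forall i j, i \in S -> j \notin S ->
        (\sum_(1 <= n <oo) ((W ^+ n) i j)%:E = 0)%E].

Definition rec_classes : {set {set 'I_N}} :=
  [set S | `[< recurrent_class S >]]%SET.

Definition Rset : {set 'I_N} := finset.cover rec_classes.

Definition Tset : {set 'I_N} := ~: (Rset :|: Dset).

(* For a recurrent class S the set below is a singleton; [0] is never used. *)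
Definition lambda_rec (S : {set 'I_N}) : 'rV[R]_#|S| :=
  xget 0 [set l | stationary_distribution (sub_mx Pmx S S) l].

(* (I - P_T)^{-1} *)
Definition fundT : 'M[R]_#|Tset| := invmx (1%:M - sub_mx Pmx Tset Tset).

Definition lambda_T : 'rV[R]_#|Tset| :=
  ((unif Tset *m fundT *m ones Tset) 0 0)^-1 *: (unif Tset *m fundT).

Definition theta_T : R :=
  (lambda_T *m sub_mx Pmx Tset Rset *m ones Rset
   + lambda_T *m sub_mx Pmx Tset Dset *m ones Dset) 0 0.

Definition beta_T : R := (((ones Tset)^T *m fundT *m ones Tset) 0 0)^-1.

Definition pi_rec (S : {set 'I_N}) : 'rV[R]_#|S| :=
  N%:R^-1 *: (#|S|%:R *: lambda_rec S
    + (#|Tset|%:R / (1 + theta_T)) *: (lambda_T *m sub_mx Pmx Tset S)).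

Definition pi_D : 'rV[R]_#|Dset| :=
  N%:R^-1 *: (#|Dset|%:R *: unif Dset
    + (#|Tset|%:R / (1 + theta_T)) *: (lambda_T *m sub_mx Pmx Tset Dset)).

Definition pi_T : 'rV[R]_#|Tset| :=
  N%:R^-1 *: ((#|Tset|%:R / (1 + theta_T)) *: lambda_T).

(* The recurrent classes, D and T partition the nodes, so for each j exactly
   one of the entries below is that of a subvector containing j. *)
Definition PureRank (j : 'I_N) : R :=
  \sum_(S in rec_classes) entry (pi_rec S) j + entry pi_D j + entry pi_T j.

(* [inl j] is the node j itself, [inr j] is its copy j'. *)
Definition in_Vhat (x : 'I_N + 'I_N) : bool :=
  match x with
  | inl _ => true
  | inr j => (Tset != finset.set0) && (j \in Rset :|: Dset)
  end.

Record Vhat := MkVhat { Vhat_val : 'I_N + 'I_N; Vhat_prf : in_Vhat Vhat_val }.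

HB.instance Definition _ := [isSub for Vhat_val].
HB.instance Definition _ := [Finite of Vhat by <:].

Definition node (j : 'I_N) : Vhat := @MkVhat (inl j) isT.

(* T as a subset of Vhat *)
Definition T_in_Vhat : {set Vhat} :=
  [set x : Vhat | if val x is inl j then j \in Tset else false]%SET.

(* the union of R' and D' *)
Definition copies : {set Vhat} :=
  [set x : Vhat | if val x is inr _ then true else false]%SET.

(* {j, j'} when j' exists, and {j} otherwise *)
Definition node_pair (j : 'I_N) : {set Vhat} :=
  [set x : Vhat | (val x == inl j) || (val x == inr j)]%SET.

Definition Mhat (x y : Vhat) : R :=
  match val x, val y with
  | inl i, inl j =>
      if i \in Tset then (if j \in Tset then Pmx i j else 0)
      else if i \in Rset then (if j \in Rset then Pmx i j else 0)
      else (i == j)%:R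
  | inl i, inr j => if i \in Tset then Pmx i j else 0
  | inr _, inl j => entry (unif Tset) j
  | inr _, inr _ => 0
  end.

Definition varpi (x : Vhat) : R := if val x is inl _ then N%:R^-1 else 0.

End Network.

Section Conditioning.
Context {d} {O : measurableType d} {R : realType} (P : probability O R).

Definition cprob (A B : set O) : R := fine (P (A `&` B)) / fine (P B).

Definition cexp (f : O -> \bar R) (B : set O) : \bar R :=
  ((fine (P B))^-1%:E * \int[P]_(w in B) f w)%E.

Definition iid_given (B : set O) (Y : nat -> O -> \bar R) : Prop :=
  [/\ forall m, measurable_fun B (Y m),
      forall (J : seq nat) (A : nat -> set (\bar R)),
        uniq J -> (forall m, measurable (A m)) ->
        cprob [set w | forall m, m \in J -> A m (Y m w)] B =
        \prod_(m <- J) cprob (Y m @^-1` A m) B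
    & forall m (A : set (\bar R)), measurable A ->
        cprob (Y m @^-1` A) B = cprob (Y 0%N @^-1` A) B].

Definition markov_chain (S : finType) (X : nat -> O -> S)
    (init : S -> R) (M : S -> S -> R) : Prop :=
  [/\ forall n x, measurable (X n @^-1` [set x]),
      forall x, P [set w | X 0%N w = x] = (init x)%:E
    & forall (n : nat) (s : nat -> S) (y : S),
        let H := [set w | forall k, (k <= n)%N -> X k w = s k] in
        (0 < P H)%E -> cprob [set w | X n.+1 w = y] H = M (s n) y].

End Conditioning.

Section Sojourn.
Context {O : Type} {R : realType} {N : nat} {W : 'M[R]_N}.
Context (X : nat -> O -> Vhat W).
Local Open Scope ereal_scope.

(* the infimum of a set of times, with inf of the empty set equal to +oo *)
Definition inf_time (A : set nat) : \bar R :=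
  ereal_inf [set n%:R%:E | n in A].

(* The predecessor is genuine: 0 <= tau k w < n forces n > 0. *)
Fixpoint tau (m : nat) (w : O) : \bar R :=
  match m with
  | 0%N => inf_time [set n | X n w \in T_in_Vhat W]
  | k.+1 => inf_time [set n | [/\ tau k w < n%:R%:E, X n w \in T_in_Vhat W
                               & X n.-1 w \in copies W]]
  end.

Definition sojourn_length (m : nat) (w : O) : \bar R :=
  tau m.+1 w - tau m w - 1.

End Sojourn.

(* Main.v *)
Require Import Defs.
From HB Require Import structures.
From mathcomp Require Import all_boot all_order all_algebra.
From mathcomp Require Import all_classical all_reals all_analysis measurable_realfun.
From mathcomp Require Import ring.

(* Occupation times: write M for the transition matrix and Pi for the kernel whose row x
   is the stationary distribution of the block of M containing x. Then
   Pi M = M Pi = Pi, and by a maximum principle on the recurrent classes and on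
   the transient nodes every M-harmonic function is constant on blocks, hence
   fixed by Pi. This makes 1 - M + Pi invertible, so the Poisson equation
   g - M g = 1_y - Pi(., y) is solvable for each state y, and along the chain the
   occupation sums of y telescope up to n times the mean of Pi(., y) under the
   initial distribution.

   Sojourns: every step out of a copy restarts the chain from the uniform
   distribution on T, so the probability of a finite pattern of sojourns
   factorizes. Outside a null set the sojourn lengths are read off such patterns,
   and their mean is the sum over n of mu_T P_T^n e, i.e. mu_T (1 - P_T)^-1 e. *)

Set Implicit Arguments.
Unset Strict Implicit.
Unset Printing Implicit Defensive.

Import Order.TTheory GRing.Theory Num.Theory.
Import numFieldNormedType.Exports.

Local Open Scope classical_set_scope.
Local Open Scope ring_scope.

(** * Stationary distributions and the Poisson equation *)

(** A recurrent class or the extended block may be periodic, so the powers of M need not converge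
    and only time averages can; the Poisson equation controls these averages directly. The extended
    block may also be reducible, since a copy can have no incoming transition, so its stationary
    distribution is singled out through harmonic functions instead of irreducibility. The factor
    |T|/(1 + theta) in PureRank comes from a renewal count: a cycle has on average 1/theta steps in
    T and one step on a copy, so T takes the fraction 1/(1 + theta) of the time, and |T|/N is the
    initial mass of T. For the sojourns, the null set consists of the paths that make a transition
    of probability zero and of those that eventually stay in T forever. *)

Lemma unitmx_cV (F : fieldType) n (A : 'M[F]_n) :
  (forall v : 'cV_n, A *m v = 0 -> v = 0) -> A \in unitmx.
Proof.
move=> A_inj; rewrite -unitmx_tr -row_free_unit; apply: inj_row_free => v vA0.
apply: trmx_inj; rewrite trmx0; apply: A_inj.
by rewrite -[A]trmxK -trmx_mul vA0 trmx0.
Qed.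

Lemma eq_of_le_sum (R : numDomainType) (I : finType) (f g : I -> R) :
  (forall i, f i <= g i) -> \sum_i g i <= \sum_i f i -> forall i, f i = g i.
Proof.
move=> fg gf i; apply/eqP; rewrite eq_sym -subr_eq0; apply/eqP.
have gf0 j : true -> 0 <= g j - f j by rewrite subr_ge0 => _; exact: fg.
apply: (psumr_eq0P gf0) => //; apply/eqP; rewrite eq_le sumr_ge0 // andbT.
by rewrite sumrB subr_le0.
Qed.

Section Stochastic.
Context {R : realType}.

(* An invariant row vector x exists because A - 1 is singular, and |x| is then
   invariant too: |x| <= |x| A entrywise while both sides have the same sum. *)
Lemma stationary_distribution_exists n (A : 'M[R]_n) :
  (0 < n)%N -> (forall i j, 0 <= A i j) -> (forall i, \sum_j A i j = 1) ->
  exists l, stationary_distribution A l.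
Proof.
move=> n0 A0 A1.
have [x x0 xA] : exists2 x : 'rV[R]_n, x != 0 & x *m A = x.
  suff : kermx (1%:M - A) != 0.
    move=> /rowV0Pn[v /sub_kermxP]; rewrite mulmxBr mulmx1 => /subr0_eq vA v0.
    by exists v.
  rewrite kermx_eq0 row_free_unit; apply/negP => U.
  (* Rows of [A] sum to 1, so [1 - A] kills the column of ones and cannot be invertible. *)
  have : (1%:M - A) *m (const_mx 1 : 'cV[R]_n) = 0.
    apply/matrixP => i j; rewrite mulmxBl mul1mx !mxE.
    by under eq_bigr => k _ do rewrite mxE mulr1; rewrite A1 subrr.
  move/(congr1 (mulmx (invmx (1%:M - A)))); rewrite mulKmx// mulmx0.
  move/matrixP/(_ (Ordinal n0) 0); rewrite !mxE => /eqP.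
  by rewrite oner_eq0.
have xj j : x 0 j = \sum_k x 0 k * A k j by rewrite -{1}xA mxE.
have absA j : `|x 0 j| = \sum_k `|x 0 k| * A k j.
  move: j; apply: (@eq_of_le_sum _ _ (fun j => `|x 0 j|)
                     (fun j => \sum_k `|x 0 k| * A k j)) => [j|].
    rewrite xj (le_trans (ler_norm_sum _ _ _))//; apply: ler_sum => k _.
    by rewrite normrM (ger0_norm (A0 _ _)).
  rewrite exchange_big /=; apply: ler_sum => k _.
  by rewrite -mulr_sumr A1 mulr1.
pose s := \sum_k `|x 0 k|.
have s0 : 0 < s.
  rewrite lt_neqAle sumr_ge0// andbT eq_sym; apply: contra x0 => /eqP s0.
  apply/eqP/rowP => k; rewrite mxE; apply/eqP; rewrite -normr_eq0; apply/eqP.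
  exact: (psumr_eq0P _ s0).
exists (s^-1 *: \row_k `|x 0 k|); split => [k||].
- by rewrite !mxE mulr_ge0// invr_ge0 ltW.
- under eq_bigr => k _ do rewrite !mxE.
  by rewrite -mulr_sumr mulVf// gt_eqF.
- rewrite -scalemxAl; congr (_ *: _); apply/rowP => j; rewrite !mxE absA.
  by apply: eq_bigr => k _; rewrite mxE.
Qed.

(* 1 - A + Q is invertible, and its inverse solves the Poisson equation. *)
Lemma poisson_matrix n (A Q : 'M[R]_n) :
  Q *m A = Q -> A *m Q = Q ->
  (forall v : 'cV[R]_n, A *m v = v -> Q *m v = v) ->
  exists G : 'M[R]_n, G - A *m G = 1%:M - Q.
Proof.
move=> QA AQ harm.
(* Each column of [Q] is harmonic by [A *m Q = Q], hence fixed by [Q]. *)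
have QQ : Q *m Q = Q.
  apply/matrixP => i j; have := harm (col j Q).
  by rewrite !colE !mulmxA AQ -!colE => /(_ erefl) /matrixP /(_ i 0); rewrite !mxE.
pose B : 'M[R]_n := 1%:M - A + Q.
have QB : Q *m B = Q by rewrite mulmxDr mulmxBr mulmx1 QA subrr add0r.
have BU : B \in unitmx.
  (* If [B] kills [v], multiplying by [Q] gives [Q *m v = 0]; then [v] is harmonic, so
     [v = Q *m v = 0]. *)
  apply: unitmx_cV => v Bv0.
  have Qv : Q *m v = 0 by rewrite -QB -mulmxA Bv0 mulmx0.
  rewrite -Qv; apply/esym/harm; move: Bv0.
  by rewrite mulmxDl Qv addr0 mulmxBl mul1mx => /subr0_eq.
exists (invmx B *m (1%:M - Q)).
set G := invmx B *m _.
have BG : B *m G = 1%:M - Q by rewrite mulKVmx.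
have QG : Q *m G = 0 by rewrite -QB -mulmxA BG mulmxBr mulmx1 QQ subrr.
by rewrite -BG mulmxDl QG addr0 mulmxBl mul1mx.
Qed.

Variables (S : finType) (M Pi : S -> S -> R).
Hypothesis PiM : forall x y, \sum_z Pi x z * M z y = Pi x y.
Hypothesis MPi : forall x y, \sum_z M x z * Pi z y = Pi x y.
Hypothesis harmonic : forall v : S -> R,
  (forall x, \sum_z M x z * v z = v x) -> forall x, \sum_z Pi x z * v z = v x.

Lemma poisson_equation y : exists g : S -> R,
  forall x, g x - \sum_z M x z * g z = (x == y)%:R - Pi x y.
Proof.
pose mx (F : S -> S -> R) : 'M[R]_#|S| :=
  \matrix_(i, j) F (enum_val i) (enum_val j).
have sumS (f : S -> R) : \sum_(k < #|S|) f (enum_val k) = \sum_z f z.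
  by rewrite [RHS](reindex (@enum_val S S))//=; apply/onW_bij/enum_val_bij.
have [|||G GE] := @poisson_matrix _ (mx M) (mx Pi).
- apply/matrixP => i j; rewrite !mxE -PiM -sumS.
  by apply: eq_bigr => k _; rewrite !mxE.
- apply/matrixP => i j; rewrite !mxE -MPi -sumS.
  by apply: eq_bigr => k _; rewrite !mxE.
- move=> v Mv; have vE i : v i 0 = (fun x => v (enum_rank x) 0) (enum_val i).
    by rewrite /= enum_valK.
  apply/matrixP => i j; rewrite ord1 mxE vE.
  rewrite -[RHS](@harmonic (fun x => v (enum_rank x) 0)) => [|x].
    by rewrite -sumS; apply: eq_bigr => k _; rewrite mxE -vE.
  rewrite -sumS; move/matrixP: Mv => /(_ (enum_rank x) 0) <-; rewrite mxE.
  by apply: eq_bigr => k _; rewrite mxE enum_rankK enum_valK.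
exists (fun x => G (enum_rank x) (enum_rank y)) => x.
move/matrixP: GE => /(_ (enum_rank x) (enum_rank y)).
rewrite !mxE !enum_rankK (inj_eq enum_rank_inj) => <-.
congr (_ - _); rewrite -sumS; apply: eq_bigr => k _.
by rewrite mxE enum_rankK enum_valK.
Qed.

(* With g solving the Poisson equation, the occupation sums telescope. *)
Lemma cesaro_cvg (p : nat -> S -> R) (y : S) :
  (forall n x, 0 <= p n x <= 1) ->
  (forall n z, p n.+1 z = \sum_x p n x * M x z) ->
  (fun n => n%:R^-1 * \sum_(0 <= nu < n) p nu y) @ \oo -->
    \sum_x p 0%N x * Pi x y.
Proof.
move=> p01 pS; have [g gE] := poisson_equation y.
set L := \sum_x p 0%N x * Pi x y.
(* [M Pi = Pi] makes the mean of [Pi _ y] under the law at time [n] constant in time. *)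
have pPi n : \sum_x p n x * Pi x y = L.
  elim: n => // n <-; under eq_bigr => x _ do rewrite pS mulr_suml.
  rewrite exchange_big /=; apply: eq_bigr => x _; rewrite -MPi mulr_sumr.
  by apply: eq_bigr => z _; rewrite mulrA.
pose b n := \sum_x p n x * g x.
have py n : p n y = L + (b n - b n.+1).
  have -> : b n.+1 = \sum_x p n x * \sum_z M x z * g z.
    rewrite /b; under eq_bigr => x _ do rewrite pS mulr_suml.
    rewrite exchange_big /=; apply: eq_bigr => x _; rewrite mulr_sumr.
    by apply: eq_bigr => z _; rewrite mulrA.
  rewrite /b -sumrB; under eq_bigr => x _ do rewrite -mulrBr gE mulrBr.
  rewrite sumrB pPi addrC subrK (bigD1 y)//= eqxx mulr1 big1 ?addr0// => x.
  by move=> /negbTE ->; rewrite mulr0.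
(* A bound uniform in time: every weight [p n x] is at most 1. *)
pose K := \sum_x `|g x|.
have bK n : `|b n| <= K.
  rewrite (le_trans (ler_norm_sum _ _ _))//; apply: ler_sum => x _.
  have /andP[p0 p1] := p01 n x.
  by rewrite normrM ger0_norm// ler_piMl.
have avgE n : (0 < n)%N ->
    n%:R^-1 * (\sum_(0 <= nu < n) p nu y) = L + n%:R^-1 * (b 0%N - b n).
  move=> n0; have -> : \sum_(0 <= nu < n) p nu y = n%:R * L + (b 0%N - b n).
    elim: n {n0} => [|n IH]; first by rewrite big_nil mul0r subrr addr0.
    by rewrite big_nat_recr//= IH py -natr1; ring.
  by rewrite mulrDr mulKf// pnatr_eq0 -lt0n.
(* The shift discards [n = 0], where [n%:R^-1] is 0 and [avgE] does not apply. *)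
rewrite -cvg_shiftS /=.
have : (fun n => L + n.+1%:R^-1 * (b 0%N - b n.+1)) @ \oo --> L.
  rewrite -[X in _ --> X]addr0; apply: cvgD; first exact: cvg_cst.
  apply/norm_cvg0P.
  apply: (@squeeze_cvgr _ _ _ _ (fun=> 0) (fun n => n.+1%:R^-1 * (K + K))).
  - near=> n; rewrite normr_ge0/= normrM ger0_norm// ler_wpM2l//.
    by rewrite (le_trans (ler_normB _ _))// lerD.
  - exact: cvg_cst.
  - rewrite -(mul0r (K + K)); apply: cvgM; last exact: cvg_cst.
    exact: cvg_harmonic.
by under eq_fun => n do rewrite -avgE//.
Unshelve. all: by end_near. Qed.

End Stochastic.

(** * Recurrent classes and maximum principles *)

(** The local step of the maximum principles: attaining the minimum propagates along every
    transition of nonzero weight, so sets of minimizers are closed under links. *)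
Lemma average_min_eq (R : numDomainType) (I : finType) (q v : I -> R) (m : R) :
  (forall j, 0 <= q j) -> \sum_j q j = 1 -> (forall j, q j != 0 -> m <= v j) ->
  \sum_j q j * v j <= m -> forall j, q j != 0 -> v j = m.
Proof.
move=> q0 q1 mv qv j qj.
have h : q j * m = q j * v j.
  move: j {qj}; apply: eq_of_le_sum => [j|]; last by rewrite -mulr_suml q1 mul1r.
  have [->|qj] := eqVneq (q j) 0; first by rewrite !mul0r.
  by rewrite ler_wpM2l// mv.
by move/(mulfI qj): h.
Qed.

(** * Coordinates of vectors and blocks indexed by sets of nodes *)

Section Entries.
Context {R : realType} {N : nat}.
Implicit Types (S : {set 'I_N}).

Lemma entry_enum_val S (v : 'rV[R]_#|S|) k : entry v (enum_val k) = v 0 k.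
Proof.
rewrite /entry (big_pred1 k)// => i.
by rewrite /= (inj_eq enum_val_inj).
Qed.

Lemma entry_notin S (v : 'rV[R]_#|S|) j : j \notin S -> entry v j = 0.
Proof.
move=> jS; rewrite /entry big_pred0// => k; apply/negbTE.
by apply: contra jS => /eqP <-; exact: enum_valP.
Qed.

Lemma sum_enum_val S (f : 'I_N -> R) :
  \sum_(k < #|S|) f (enum_val k) = \sum_(j in S) f j.
Proof. by rewrite [RHS]big_enum_val. Qed.

Lemma sum_entry S (v : 'rV[R]_#|S|) (f : 'I_N -> R) :
  \sum_j entry v j * f j = \sum_k v 0 k * f (enum_val k).
Proof.
transitivity (\sum_(j in S) entry v j * f j).
  rewrite [RHS]big_mkcond; apply: eq_bigr => j _; case: ifPn => // jS.
  by rewrite entry_notin ?mul0r.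
by rewrite -sum_enum_val; apply: eq_bigr => k _; rewrite entry_enum_val.
Qed.

(** Entries vanish outside their index set, so a product with a block becomes a sum over all nodes;
    later computations then avoid ordinals of [#|S|]. *)
Lemma entry_mul S S' (v : 'rV[R]_#|S|) (A : 'M[R]_N) j : j \in S' ->
  entry (v *m sub_mx A S S') j = \sum_i entry v i * A i j.
Proof.
move=> jS'; rewrite -[j in LHS](enum_rankK_in jS' jS') entry_enum_val mxE.
by rewrite sum_entry; apply: eq_bigr => k _; rewrite mxE enum_rankK_in.
Qed.

Lemma entry_unif S j : entry (unif S : 'rV[R]_#|S|) j = (j \in S)%:R / #|S|%:R.
Proof.
have [jS|jS] := boolP (j \in S); last by rewrite entry_notin ?mul0r.
by rewrite -(enum_rankK_in jS jS) entry_enum_val !mxE mulr1 mul1r.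
Qed.

Lemma entryZ S (v : 'rV[R]_#|S|) (a : R) j : entry (a *: v) j = a * entry v j.
Proof. by rewrite /entry mulr_sumr; apply: eq_bigr => k _; rewrite mxE. Qed.

Lemma entryD S (u v : 'rV[R]_#|S|) j : entry (u + v) j = entry u j + entry v j.
Proof. by rewrite /entry -big_split; apply: eq_bigr => k _; rewrite mxE. Qed.

End Entries.

Section Graph.
Context {R : realType} {N : nat} (W : 'M[R]_N).
Hypothesis W_ge0 : forall i j, 0 <= W i j.
Local Notation p := (Pmx W).
Local Notation D := (Dset W).
Local Notation T := (Tset W).

Lemma wout_ge0 i : 0 <= wout W i. Proof. exact: sumr_ge0. Qed.

Lemma Pmx_ge0 i j : 0 <= p i j.
Proof. by rewrite mxE; case: ifPn => // w0; rewrite divr_ge0// ltW. Qed.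

Lemma notin_Dset i : (i \notin D) = (0 < wout W i).
Proof. by rewrite inE lt_neqAle wout_ge0 andbT eq_sym. Qed.

Lemma Pmx_eq0 i j : i \notin D -> (p i j == 0) = (W i j == 0).
Proof.
by rewrite notin_Dset mxE => w0; rewrite w0 mulf_eq0 invr_eq0 (gt_eqF w0) orbF.
Qed.

Lemma Pmx_sum i : i \notin D -> \sum_j p i j = 1.
Proof.
rewrite notin_Dset => w0; under eq_bigr => j _ do rewrite mxE w0.
by rewrite -mulr_suml mulfV// gt_eqF.
Qed.

(** Boolean, so that minimal closed sets can be extracted by [minset_exists]. *)
Definition link_closed (U : {set 'I_N}) :=
  [forall i in U, forall j, (W i j != 0) ==> (j \in U)].

Lemma link_closedP (U : {set 'I_N}) :
  reflect (forall i j, i \in U -> W i j != 0 -> j \in U) (link_closed U).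
Proof.
apply: (iffP forall_inP) => [h i j iU|h i iU].
  by apply/implyP; move/forallP: (h i iU).
by apply/forallP => j; apply/implyP/h.
Qed.

Lemma Wpow_ge0 n i j : 0 <= (W ^+ n) i j.
Proof.
elim: n i j => [|n IH] i j; first by rewrite expr0 mxE ler0n.
rewrite exprS [X in _ <= X](_ : _ = (W *m (W ^+ n)) i j)// mxE.
by apply: sumr_ge0 => k _; rewrite mulr_ge0.
Qed.

Lemma Wpow_step n i j k : 0 < (W ^+ n) i j -> W j k != 0 -> 0 < (W ^+ n.+1) i k.
Proof.
move=> Wn Wjk; rewrite exprSr [X in _ < X](_ : _ = ((W ^+ n) *m W) i k)// mxE.
rewrite (bigD1 j)//= ltr_wpDr//.
  by apply: sumr_ge0 => l _; rewrite mulr_ge0// Wpow_ge0.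
by rewrite mulr_gt0// lt_neqAle eq_sym Wjk W_ge0.
Qed.

Lemma Wpow_closed (U : {set 'I_N}) n i j :
  link_closed U -> i \in U -> j \notin U -> (W ^+ n) i j = 0.
Proof.
move=> /link_closedP Ucl iU jU; elim: n i iU => [|n IH] i iU.
  by rewrite expr0 mxE; case: eqP jU => // <-; rewrite iU.
rewrite exprS [LHS](_ : _ = (W *m (W ^+ n)) i j)// mxE big1// => k _.
have [->|Wik] := eqVneq (W i k) 0; first by rewrite mul0r.
by rewrite IH ?mulr0//; exact: Ucl Wik.
Qed.

Lemma Wseries_gt0P i j :
  (0 < \sum_(1 <= n <oo) ((W ^+ n) i j)%:E)%E <->
  exists n, 0 < (W ^+ n.+1) i j.
Proof.
split=> [|[n Wn]].
  apply: contraPP => /forallNP h; rewrite eseries0 ?ltxx// => -[|n]// _ _.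
  apply/eqP; rewrite eqe eq_le Wpow_ge0 andbT leNgt.
  exact/negP/h.
apply: (@lt_le_trans _ _ (\sum_(1 <= k < n.+2) ((W ^+ k) i j)%:E)%E); last first.
  by apply: nneseries_lim_ge => k _ _; rewrite lee_fin Wpow_ge0.
rewrite big_nat_recr//= sumEFin -EFinD lte_fin ltr_wpDl//.
by apply: sumr_ge0 => k _; exact: Wpow_ge0.
Qed.

Lemma Wseries_eq0 i j :
  (\sum_(1 <= n <oo) ((W ^+ n) i j)%:E = 0)%E -> forall n, (W ^+ n.+1) i j = 0.
Proof.
move=> s0 n; apply/eqP; rewrite eq_le Wpow_ge0 andbT leNgt; apply/negP => Wn.
have /Wseries_gt0P : exists n, 0 < (W ^+ n.+1) i j by exists n.
by rewrite s0 ltxx.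
Qed.

Lemma recurrent_class_closed S : recurrent_class W S -> link_closed S.
Proof.
move=> [_ _ _ h]; apply/link_closedP => i j iS; apply: contraNT => jS.
by apply/eqP; have := Wseries_eq0 (h i j iS jS) 0; rewrite expr1.
Qed.

(** No power of [W] leads out of the closed set [U], while any node of [S] outside [U] would be
    reachable from [U] inside the class. *)
Lemma recurrent_class_minimal S U : recurrent_class W S -> link_closed U ->
  U \subset S -> U != finset.set0 -> U = S.
Proof.
move=> [_ _ h _] Ucl US /finset.set0Pn[i iU]; apply/eqP; rewrite finset.eqEsubset US/=.
apply/fintype.subsetP => j jS; apply: contraT => jU.
have /Wseries_gt0P[n] := h i j (fintype.subsetP US i iU) jS.
by rewrite (Wpow_closed _ Ucl iU jU) ltxx.
Qed.

Lemma rec_classesP S : reflect (recurrent_class W S) (S \in rec_classes W).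
Proof. by rewrite inE; exact: asboolP. Qed.

(** The intersection of two classes is closed and nonempty, so minimality identifies it with
    both. *)
Lemma rec_classes_inj S S' i : S \in rec_classes W -> S' \in rec_classes W ->
  i \in S -> i \in S' -> S = S'.
Proof.
move=> /rec_classesP hS /rec_classesP hS' iS iS'.
have cl : link_closed (S :&: S').
  apply/link_closedP => k l /finset.setIP[kS kS'] Wkl; rewrite inE.
  rewrite (link_closedP _ (recurrent_class_closed hS) _ _ kS Wkl).
  by rewrite (link_closedP _ (recurrent_class_closed hS') _ _ kS' Wkl).
have n0 : S :&: S' != finset.set0 by apply/finset.set0Pn; exists i; rewrite inE iS.
rewrite -(recurrent_class_minimal hS cl (finset.subsetIl _ _) n0).
by rewrite (recurrent_class_minimal hS' cl (finset.subsetIr _ _) n0).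
Qed.

(* A minimal nonempty closed set of non-dangling nodes is a recurrent class. *)
Lemma Tset_closed_eq0 U : link_closed U -> U \subset T -> U = finset.set0.
Proof.
move=> Ucl UT; apply/eqP; apply: contraT => U0.
pose Q V := link_closed V && (V != finset.set0).
have [|S Smin SU] := @minset_exists _ Q U; first by rewrite /Q Ucl.
have /minsetP[/andP[Scl S0] minS] := Smin.
have ST := fintype.subset_trans SU UT.
have SD i : i \in S -> i \notin D.
  by move/(fintype.subsetP ST); rewrite !inE negb_or => /andP[].
suff /rec_classesP Src : recurrent_class W S.
  have /finset.set0Pn[i iS] := S0.
  have := fintype.subsetP ST i iS; rewrite !inE negb_or => /andP[/negP iR _]; case: iR.
  by apply/finset.bigcupP; exists S.
split => // [|i j iS jS|i j iS jS].
- by apply/fintype.subsetP => i /SD; rewrite finset.in_setC.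
- apply/Wseries_gt0P.
  (* The nodes reachable from [i] in at least one step form a closed set, so by minimality they
     exhaust [S]; the set is nonempty because [i] is not dangling. *)
  pose V := [set k in S | `[< exists n, 0 < (W ^+ n.+1) i k >]]%SET.
  suff /finset.setP/(_ j) : V = S by rewrite inE jS => /asboolP.
  apply: minS; last by apply/fintype.subsetP => k /finset.setIdP[].
  apply/andP; split.
    apply/link_closedP => k l /finset.setIdP[kS /asboolP[n Wn]] Wkl; rewrite inE.
    rewrite (link_closedP _ Scl _ _ kS Wkl); apply/asboolP.
    by exists n.+1; exact: Wpow_step Wn Wkl.
  have : 0 < wout W i by rewrite -notin_Dset SD.
  have [[k Wik] _|/forallNP h] := pselect (exists k, W i k != 0).
    apply/finset.set0Pn; exists k; rewrite inE (link_closedP _ Scl _ _ iS Wik).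
    by apply/asboolP; exists 0%N; rewrite expr1 lt_neqAle eq_sym Wik W_ge0.
  rewrite /wout big1 ?ltxx// => k _; apply/eqP/negPn/negP; exact: h.
- rewrite eseries0// => n _ _.
  by rewrite (Wpow_closed _ Scl iS jS).
Qed.

Lemma Tset_notD i : i \in T -> i \notin D.
Proof. by rewrite !inE negb_or => /andP[]. Qed.

Lemma recurrent_notD S i : recurrent_class W S -> i \in S -> i \notin D.
Proof. by move=> [_ /fintype.subsetP h _ _] /h; rewrite finset.in_setC. Qed.

(** The set where [v] attains its minimum over [S] is closed and nonempty, hence all of [S] by
    minimality. *)
Lemma recurrent_harmonic_const S (v : 'I_N -> R) : recurrent_class W S ->
  (forall i, i \in S -> \sum_j p i j * v j = v i) ->
  forall i j, i \in S -> j \in S -> v i = v j.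
Proof.
move=> hS vh; have /link_closedP Scl := recurrent_class_closed hS.
suff [m vm] : exists m, forall i, i \in S -> v i = m.
  by move=> i j iS jS; rewrite !vm.
have [/finset.set0Pn[i0 i0S] _ _ _] := hS.
case: (@arg_minP _ _ _ i0 [in S] v i0S) => i1 i1S vmin; exists (v i1).
pose U := [set i in S | v i == v i1]%SET.
suff US : U = S by move=> i; rewrite -US => /finset.setIdP[_ /eqP].
apply: recurrent_class_minimal => //; last 2 first.
- by apply/fintype.subsetP => i /finset.setIdP[].
- by apply/finset.set0Pn; exists i1; rewrite inE [i1 \in S]i1S eqxx.
apply/link_closedP => i j /finset.setIdP[iS /eqP vi] Wij; rewrite inE (Scl _ _ iS Wij)/=.
have iD := recurrent_notD hS iS.
apply/eqP; apply: (average_min_eq (q := p i)); first exact: Pmx_ge0.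
- exact: Pmx_sum.
- by move=> k; rewrite Pmx_eq0// => Wik; apply/vmin/(Scl _ _ iS Wik).
- by rewrite vh// vi.
- by rewrite Pmx_eq0.
Qed.

(** Extend [v] by 0 outside T. A negative minimum would be attained only inside T, and its
    minimizers would form a nonempty closed subset of T. *)
Lemma Tset_min_principle (v : 'I_N -> R) :
  (forall i, i \in T -> \sum_(j in T) p i j * v j <= v i) ->
  forall i, i \in T -> 0 <= v i.
Proof.
move=> vsuper i0 i0T; rewrite leNgt; apply/negP => vi0.
pose w j := if j \in T then v j else 0.
have wE i : \sum_(j in T) p i j * v j = \sum_j p i j * w j.
  rewrite big_mkcond; apply: eq_bigr => j _; rewrite /w.
  by case: ifP => // _; rewrite mulr0.
case: (@arg_minP _ _ _ i0 predT w isT) => i1 _ wmin.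
have wneg : w i1 < 0 by rewrite (le_lt_trans (wmin i0 isT))// /w i0T.
pose U := [set i | w i == w i1]%SET.
have UT i : i \in U -> i \in T.
  rewrite inE; apply: contraTT => /negbTE iT; rewrite /w iT eq_sym -/(w i1).
  by rewrite lt_eqF.
have /finset.setP/(_ i1) : U = finset.set0; last by rewrite !inE eqxx.
apply: Tset_closed_eq0; last exact/fintype.subsetP.
apply/link_closedP => i j iU Wij.
have iT := UT i iU; have iD := Tset_notD iT.
rewrite inE; apply/eqP; apply: (average_min_eq (q := p i)).
- exact: Pmx_ge0.
- exact: Pmx_sum.
- by move=> k _; exact: wmin.
- rewrite -wE (le_trans (vsuper _ iT))//.
  by move: iU; rewrite inE => /eqP <-; rewrite /w iT.
- by rewrite Pmx_eq0.
Qed.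

(** The uniqueness tool on T: it yields the invertibility of I - P_T, the constancy of harmonic
    functions on T and the value of the series of powers of P_T. *)
Lemma Tset_eq0_principle (v : 'I_N -> R) :
  (forall i, i \in T -> \sum_(j in T) p i j * v j = v i) ->
  forall i, i \in T -> v i = 0.
Proof.
move=> vh i iT; apply/eqP; rewrite eq_le -oppr_ge0; apply/andP; split.
  apply: (@Tset_min_principle (fun i => - v i)) => // j jT.
  by under eq_bigr do rewrite mulrN; rewrite sumrN vh.
by apply: Tset_min_principle => // j jT; rewrite vh.
Qed.

End Graph.

(** * Transient nodes: the fundamental matrix and the mean sojourn time *)

Section TransientPart.
Context {R : realType} {N : nat} (W : 'M[R]_N).
Hypothesis W_ge0 : forall i j, 0 <= W i j.
Local Notation p := (Pmx W).
Local Notation D := (Dset W).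
Local Notation T := (Tset W).
Local Notation PT := (sub_mx p T T).

Lemma sub1_PT_unit : 1%:M - PT \in unitmx.
Proof.
apply: unitmx_cV => v; rewrite mulmxBl mul1mx => /subr0_eq vE.
suff v0 i : i \in T -> entry v^T i = 0.
  apply/colP => k; have := v0 _ (enum_valP k).
  by rewrite entry_enum_val !mxE.
apply: Tset_eq0_principle => {i} // i iT.
rewrite -(enum_rankK_in iT iT) entry_enum_val [RHS]mxE [in RHS]vE [RHS]mxE.
rewrite -sum_enum_val; apply: eq_bigr => k _.
by rewrite entry_enum_val [v^T _ _]mxE [sub_mx _ _ _ _ _]mxE.
Qed.

(* [sojourn i] is the mean time spent in T before the first exit, from i. *)
Definition sojourn (i : 'I_N) : R := entry (fundT W *m ones T)^T i.

(** First-step analysis, read off from (I - P_T)(I - P_T)^-1 e = e. *)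
Lemma sojourn_step i : i \in T ->
  sojourn i = 1 + \sum_(j in T) p i j * sojourn j.
Proof.
move=> iT; have : (1%:M - PT) *m (fundT W *m ones T) = ones T.
  by rewrite mulKVmx// sub1_PT_unit.
rewrite mulmxBl mul1mx => /eqP; rewrite subr_eq => /eqP vE.
rewrite /sojourn; set v := _ *m ones T in vE *.
rewrite -(enum_rankK_in iT iT) entry_enum_val mxE {1}vE 3!mxE -sum_enum_val.
congr (_ + _); apply: eq_bigr => k _.
by rewrite entry_enum_val [v^T _ _]mxE [sub_mx _ _ _ _ _]mxE.
Qed.

(** By the recursion it suffices that [sojourn] is nonnegative on T, which follows from the minimum
    principle because the summand 1 makes it superharmonic. *)
Lemma sojourn_ge1 i : i \in T -> 1 <= sojourn i.
Proof.
move=> iT; rewrite sojourn_step// lerDl; apply: sumr_ge0 => j jT.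
rewrite mulr_ge0 ?Pmx_ge0//; move: j jT; apply: Tset_min_principle => // j jT.
by rewrite [leRHS]sojourn_step// lerDr.
Qed.

(** The normalizing constant of [lambda_T]; its inverse is [theta_T]. *)
Definition mean_sojourn : R := (unif T *m fundT W *m ones T) 0 0.

Lemma mean_sojournE :
  mean_sojourn = \sum_i entry (unif T : 'rV[R]_#|T|) i * sojourn i.
Proof.
rewrite sum_entry /mean_sojourn -mulmxA mxE; apply: eq_bigr => k _.
by rewrite /sojourn entry_enum_val [X in _ = _ * X]mxE.
Qed.

Lemma sum_unif (S : {set 'I_N}) : S != finset.set0 ->
  \sum_i entry (unif S : 'rV[R]_#|S|) i = 1.
Proof.
rewrite -card_gt0 => S0; under eq_bigr => i _ do rewrite entry_unif.
rewrite -mulr_suml (eq_bigr (fun i => if i \in S then 1 else 0)).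
  by rewrite -big_mkcond sumr_const mulfV// pnatr_eq0 -lt0n.
by move=> i _; case: ifP.
Qed.

Lemma unif_ge0 (S : {set 'I_N}) i : 0 <= entry (unif S : 'rV[R]_#|S|) i.
Proof. by rewrite entry_unif divr_ge0. Qed.

Hypothesis T0 : T != finset.set0.

Lemma mean_sojourn_ge1 : 1 <= mean_sojourn.
Proof.
rewrite mean_sojournE -(sum_unif T0); apply: ler_sum => i _.
have [iT|iT] := boolP (i \in T); last by rewrite entry_notin// mul0r.
by rewrite ler_peMr ?unif_ge0// sojourn_ge1.
Qed.

Lemma mean_sojourn_gt0 : 0 < mean_sojourn.
Proof. exact: lt_le_trans mean_sojourn_ge1. Qed.

Local Notation lam := (entry (lambda_T W)).

Lemma lambda_T_sum : \sum_i lam i = 1.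
Proof.
under eq_bigr => i _ do rewrite -[entry _ _]mulr1.
rewrite (sum_entry _ (fun=> 1)) (eq_bigr (fun k => lambda_T W 0 k * ones T k 0)).
  rewrite -[LHS](_ : (lambda_T W *m ones T) 0 0 = _); last by rewrite mxE.
  by rewrite /lambda_T -scalemxAl mxE mulVf// gt_eqF// mean_sojourn_gt0.
by move=> k _; rewrite [ones T _ _]mxE.
Qed.

(** The balance equation lambda_T (I - P_T) = mu_T / [mean_sojourn]: the mass lost by exits from T
    is put back uniformly. *)
Lemma lambda_T_step j : j \in T ->
  lam j = \sum_i lam i * p i j + mean_sojourn^-1 * entry (unif T) j.
Proof.
move=> jT; rewrite -(entry_mul _ _ jT) -entryZ -entryD; congr entry.
apply/eqP; rewrite addrC -subr_eq -[X in X - _]mulmx1 -mulmxBr.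
by rewrite -scalemxAl mulmxKV// sub1_PT_unit.
Qed.

Lemma Rset_Dset_disjoint : fintype.disjoint (mem (Rset W)) (mem D).
Proof.
apply/pred0P => i /=; apply/negbTE/negP => /andP[/finset.bigcupP[S]].
by move=> /rec_classesP hS iS; apply/negP/(recurrent_notD hS iS).
Qed.

Lemma theta_T_out : theta_T W = \sum_(j in ~: T) \sum_i lam i * p i j.
Proof.
have aux S : (lambda_T W *m sub_mx p T S *m ones S) 0 0 =
             \sum_(j in S) \sum_i lam i * p i j.
  rewrite mxE -sum_enum_val; apply: eq_bigr => k _.
  rewrite -(entry_mul _ _ (enum_valP k)) entry_enum_val.
  by rewrite [ones S _ _]mxE mulr1.
rewrite /theta_T mxE !aux finset.setCK.
rewrite (eq_bigl _ _ (fun i => finset.in_setU i _ _)) bigU//.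
exact: Rset_Dset_disjoint.
Qed.

(** The vector lambda_T P has total mass 1. Summing the balance equation over T shows that 1 -
    1/[mean_sojourn] of it stays in T, and [theta_T] is the remainder. *)
Lemma theta_T_mean : theta_T W = mean_sojourn^-1.
Proof.
have : \sum_j \sum_i lam i * p i j = 1.
  rewrite exchange_big /= -[RHS]lambda_T_sum; apply: eq_bigr => i _.
  rewrite -mulr_sumr; have [iT|iT] := boolP (i \in T).
    by rewrite Pmx_sum// ?mulr1// Tset_notD.
  by rewrite entry_notin// mul0r.
rewrite (bigID (mem T))/=.
have -> : \sum_(j in T) \sum_i lam i * p i j = 1 - mean_sojourn^-1.
  transitivity (\sum_(j in T) (lam j - mean_sojourn^-1 * entry (unif T) j)).
    by apply: eq_bigr => j jT; rewrite [X in X - _]lambda_T_step// addrK.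
  rewrite sumrB -mulr_sumr.
  have sumT (f : 'rV[R]_#|T|) : \sum_(j in T) entry f j = \sum_j entry f j.
    rewrite big_mkcond; apply: eq_bigr => j _; case: ifPn => // jT.
    by rewrite entry_notin.
  by rewrite !sumT lambda_T_sum sum_unif// mulr1.
rewrite theta_T_out => /(canRL (addKr _)) => h.
under eq_bigl do rewrite finset.in_setC.
by rewrite h; ring.
Qed.

Lemma theta_T_gt0 : 0 < theta_T W.
Proof. by rewrite theta_T_mean invr_gt0 mean_sojourn_gt0. Qed.

Lemma mean_sojourn_beta : (#|T|%:R * beta_T W)^-1 = mean_sojourn.
Proof.
rewrite invfM /beta_T invrK /mean_sojourn /unif -!scalemxAl [in RHS]mxE.
by [].
Qed.

End TransientPart.

(** * The limit kernel *)

Section LimitKernel.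
Context {R : realType} {N : nat} (W : 'M[R]_N).
Hypothesis W_ge0 : forall i j, 0 <= W i j.
Local Notation p := (Pmx W).
Local Notation D := (Dset W).
Local Notation T := (Tset W).
Local Notation lam := (entry (lambda_T W)).
Local Notation th := (theta_T W).
Local Notation uT := (entry (unif T)).

(** Splits a sum over nodes and copies. The summand has to be a function on the whole disjoint sum,
    which is why the kernels below are defined there. *)
Lemma sum_Vhat (g : 'I_N + 'I_N -> R) :
  \sum_(x : Vhat W) g (val x) =
  \sum_i g (inl i) + (if T != finset.set0 then \sum_(i in ~: T) g (inr i) else 0).
Proof.
transitivity (\sum_(s | in_Vhat W s) g s).
  rewrite [RHS](reindex_omap (val : Vhat W -> _) insub) => [|s sV].
    by apply: eq_bigl => x; rewrite valK eqxx (valP x).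
  by rewrite insubT.
rewrite big_sumType /=; congr (_ + _).
case: ifPn => [T0|]; last by rewrite big_pred0.
by apply: eq_bigl => i; rewrite finset.setCK.
Qed.

Lemma setC_Tset i : (i \in Rset W :|: D) = (i \notin T).
Proof. by rewrite finset.in_setC negbK. Qed.

Lemma RsetP i : reflect (exists2 S, recurrent_class W S & i \in S) (i \in Rset W).
Proof.
apply: (iffP finset.bigcupP) => [[S /rec_classesP]|[S hS iS]]; first by exists S.
by exists S => //; apply/rec_classesP.
Qed.

Lemma recurrent_Rset S i : recurrent_class W S -> i \in S -> i \in Rset W.
Proof. by move=> hS iS; apply/RsetP; exists S. Qed.

Lemma Rset_notT i : i \in Rset W -> i \notin T.
Proof. by move=> iR; rewrite -setC_Tset finset.in_setU iR. Qed.

Lemma Rset_notD i : i \in Rset W -> i \notin D.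
Proof. by case/RsetP => S hS; exact: recurrent_notD. Qed.

Lemma recurrent_Pmx_eq0 S i j : recurrent_class W S -> i \in S -> j \notin S ->
  p i j = 0.
Proof.
move=> hS iS; apply: contraNeq; rewrite Pmx_eq0// ?(recurrent_notD hS)//.
exact: (link_closedP _ _ (recurrent_class_closed W_ge0 hS)).
Qed.

Lemma lambda_recP S : recurrent_class W S ->
  stationary_distribution (sub_mx p S S) (lambda_rec W S).
Proof.
move=> hS; apply: xgetPex; apply: stationary_distribution_exists.
- by have [S0 _ _ _] := hS; rewrite card_gt0.
- by move=> i j; rewrite mxE Pmx_ge0.
- move=> k; rewrite -(Pmx_sum W_ge0 (recurrent_notD hS (enum_valP k))).
  under eq_bigr do rewrite mxE.
  rewrite (sum_enum_val _ (fun j => p (enum_val k) j)) big_mkcond.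
  apply: eq_bigr => j _; case: ifPn => // jS.
  by rewrite (recurrent_Pmx_eq0 hS (enum_valP k) jS).
Qed.

Lemma lambda_rec_sum S : recurrent_class W S ->
  \sum_j entry (lambda_rec W S) j = 1.
Proof.
move=> /lambda_recP[_ <- _]; have := sum_entry (lambda_rec W S) (fun=> 1).
by under eq_bigr do rewrite mulr1; under [in X in _ = X]eq_bigr do rewrite mulr1.
Qed.

Lemma lambda_rec_step S j : recurrent_class W S ->
  \sum_i entry (lambda_rec W S) i * p i j = entry (lambda_rec W S) j.
Proof.
move=> hS; have [jS|jS] := boolP (j \in S).
  by rewrite -(entry_mul _ p jS); have [_ _ ->] := lambda_recP hS.
rewrite [RHS]entry_notin// big1// => i _; have [iS|iS] := boolP (i \in S).
  by rewrite (recurrent_Pmx_eq0 hS)// mulr0.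
by rewrite entry_notin// mul0r.
Qed.

(** At most one term is nonzero, because the classes are disjoint. *)
Definition limit_rec (i j : 'I_N) : R :=
  \sum_(S in rec_classes W) (i \in S)%:R * entry (lambda_rec W S) j.

Lemma limit_recE S i j : recurrent_class W S -> i \in S ->
  limit_rec i j = entry (lambda_rec W S) j.
Proof.
move=> hS iS; have SR : S \in rec_classes W by apply/rec_classesP.
rewrite /limit_rec (bigD1 S)//= iS mul1r big1 ?addr0// => S' /andP[S'R S'S].
have [iS'|_] := boolP (i \in S'); last by rewrite mul0r.
by rewrite (rec_classes_inj W_ge0 S'R SR iS' iS) eqxx in S'S.
Qed.

(* The stationary distribution of the block of M on the extended transient
   part: one sojourn in T has mean length 1/theta and is followed by one step
   on a copy. *)
Definition limit_T (s : 'I_N + 'I_N) : R :=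
  match s with
  | inl j => lam j / (1 + th)
  | inr j => (\sum_i lam i * p i j) / (1 + th)
  end.

(** The kernel Pi. A row depends only on the block of [s]; dangling nodes are absorbing and form one
    block each. *)
Definition limit_kernel (s t : 'I_N + 'I_N) : R :=
  match s with
  | inl i => if i \in T then limit_T t
             else if i \in Rset W then (if t is inl j then limit_rec i j else 0)
             else (s == t)%:R
  | inr _ => limit_T t
  end.

(* [Mhat] extended to copies that may not exist, so that sums over [Vhat] can be
   split by [sum_Vhat]. *)
Definition Mraw (s t : 'I_N + 'I_N) : R :=
  match s, t with
  | inl i, inl j =>
      if i \in T then (if j \in T then p i j else 0)
      else if i \in Rset W then (if j \in Rset W then p i j else 0)
      else (i == j)%:R
  | inl i, inr j => if i \in T then p i j else 0
  | inr _, inl j => uT j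
  | inr _, inr _ => 0
  end.

Lemma MhatE (x y : Vhat W) : Mhat x y = Mraw (val x) (val y).
Proof. by []. Qed.

Lemma Mhat_ge0 (x y : Vhat W) : 0 <= Mhat x y.
Proof.
rewrite MhatE /Mraw; case: (val x) (val y) => [i|i] [j|j] //.
- by do 2 ?case: ifP => _; rewrite ?Pmx_ge0 ?ler0n//; case: ifP; rewrite ?Pmx_ge0.
- by case: ifP; rewrite ?Pmx_ge0.
- exact: unif_ge0.
Qed.

Lemma Mhat_sum (x : Vhat W) : \sum_y Mhat x y = 1.
Proof.
rewrite (sum_Vhat (Mraw (val x))); case: x => -[i|i] /= xV.
- have [iT|iT] := boolP (i \in T).
    have -> : T != finset.set0 by apply/finset.set0Pn; exists i.
    rewrite -(Pmx_sum W_ge0 (Tset_notD iT)) [RHS](bigID (mem T))/=.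
    rewrite -big_mkcond/=; congr (_ + _); apply: eq_bigl => j.
    by rewrite finset.in_setC.
  rewrite [X in _ + X](_ : _ = 0) ?addr0; last by case: ifP => // _; rewrite big1.
  have [/RsetP[S hS iS]|iR] := boolP (i \in Rset W).
    rewrite -(Pmx_sum W_ge0 (recurrent_notD hS iS)).
    apply: eq_bigr => j _; case: ifPn => // jR.
    rewrite (recurrent_Pmx_eq0 hS)//; apply: contra jR.
    exact: recurrent_Rset hS.
  rewrite (bigD1 i)//= eqxx big1 ?addr0// => j.
  by rewrite eq_sym => /negbTE ->.
- have /andP[T0 _] := xV.
  by rewrite sum_unif// T0 big1// addr0.
Qed.

(** A transition of nonzero weight never leaves its block: a recurrent class, the extended transient
    part or a single dangling node. *)
Lemma limit_kernel_block (x z : Vhat W) t : Mhat x z != 0 ->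
  limit_kernel (val z) t = limit_kernel (val x) t.
Proof.
rewrite MhatE; case: x z => -[i|i] xV [[j|j] zV] /=; last by rewrite eqxx.
- have [iT|iT] := boolP (i \in T).
    by case: ifPn; rewrite ?eqxx.
  have [/RsetP[S hS iS]|iR] := boolP (i \in Rset W).
    case: ifPn => jR; last by rewrite eqxx.
    move=> pij; have jS : j \in S.
      by apply: contraNT pij => jS; rewrite (recurrent_Pmx_eq0 hS iS jS).
    rewrite (negbTE (Rset_notT jR)); case: t => // k.
    by rewrite !(limit_recE _ hS).
  by have [<-|] := eqVneq i j; rewrite ?eqxx// (negbTE iT) (negbTE iR).
- by case: ifP; rewrite ?eqxx.
- have [//|jT] := boolP (j \in T).
  by rewrite entry_notin ?eqxx.
Qed.

(** The rows of the kernel are constant along transitions, and the rows of M sum to 1. *)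
Lemma Mhat_limit_kernel (x y : Vhat W) :
  \sum_z Mhat x z * limit_kernel (val z) (val y) = limit_kernel (val x) (val y).
Proof.
rewrite (eq_bigr (fun z => Mhat x z * limit_kernel (val x) (val y))).
  by rewrite -mulr_suml Mhat_sum mul1r.
move=> z _; have [->|Mxz] := eqVneq (Mhat x z) 0; first by rewrite !mul0r.
by rewrite (limit_kernel_block _ Mxz).
Qed.

(** A copy is entered only from T, with exactly the mass that [limit_T] gives it. A node of T
    receives mass from T and from the copies, whose total mass theta/(1 + theta) is spread
    uniformly; since theta = 1/[mean_sojourn], this is the balance equation. *)
Lemma limit_T_step (t : Vhat W) : T != finset.set0 ->
  \sum_z limit_T (val z) * Mhat z t = limit_T (val t).
Proof.
move=> T0; have th1 : 1 + th != 0.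
  by rewrite gt_eqF// addr_gt0// theta_T_gt0.
rewrite (sum_Vhat (fun s => limit_T s * Mraw s (val t))) T0.
case: t => -[j|j] tV /=; last first.
  rewrite [X in _ + X]big1 ?addr0 => [|i _]; last by rewrite mulr0.
  rewrite mulr_suml; apply: eq_bigr => i _.
  have [iT|iT] := boolP (i \in T); first by rewrite mulrAC.
  by rewrite entry_notin// !mul0r.
under [in X in _ + X]eq_bigr do rewrite mulrAC.
rewrite -!mulr_suml -theta_T_out//.
have [jT|jT] := boolP (j \in T); last first.
  rewrite [uT j]entry_notin// mulr0 mul0r addr0 [lam j]entry_notin// mul0r.
  rewrite big1// => i _; have [iT|iT] := boolP (i \in T); first by rewrite mulr0.
  by rewrite [lam i]entry_notin// !mul0r.
rewrite [in RHS]lambda_T_step// -theta_T_mean// mulrDl; congr (_ + _).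
rewrite mulr_suml; apply: eq_bigr => i _.
have [iT|iT] := boolP (i \in T); first by rewrite mulrAC.
by rewrite entry_notin// !mul0r.
Qed.

Lemma limit_T_sum : T != finset.set0 -> \sum_(z : Vhat W) limit_T (val z) = 1.
Proof.
move=> T0; rewrite sum_Vhat T0 /= -!mulr_suml lambda_T_sum// -theta_T_out//.
by rewrite -mulrDl mulfV// gt_eqF// addr_gt0// theta_T_gt0.
Qed.

Lemma limit_kernel_Mhat (x y : Vhat W) :
  \sum_z limit_kernel (val x) (val z) * Mhat z y = limit_kernel (val x) (val y).
Proof.
case: x => -[i|i] xV /=; last by have /andP[T0 _] := xV; rewrite limit_T_step.
have [iT|iT] := boolP (i \in T).
  by rewrite limit_T_step//; apply/finset.set0Pn; exists i.
have [/RsetP[S hS iS]|iR] := boolP (i \in Rset W); last first.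
  rewrite (bigD1 (node W i))//= eqxx mul1r big1 ?addr0 => [|z zi].
    by rewrite MhatE /= (negbTE iT) (negbTE iR); case: (val y).
  have -> : (inl i == val z) = false.
    apply: contraNF zi => /eqP zi; apply/eqP/val_inj.
    by rewrite -zi.
  by rewrite mul0r.
rewrite (sum_Vhat (fun s => (if s is inl j then limit_rec i j else 0) *
                            Mraw s (val y))) /=.
rewrite [X in _ + X](_ : _ = 0) ?addr0; last first.
  by case: ifP => // _; rewrite big1// => k _; rewrite mul0r.
under eq_bigr do rewrite (limit_recE _ hS iS).
case: (val y) => j.
  rewrite (limit_recE _ hS iS) -(lambda_rec_step _ hS); apply: eq_bigr => k _.
  have [kS|kS] := boolP (k \in S); last by rewrite entry_notin// !mul0r.
  have kR := recurrent_Rset hS kS; rewrite (negbTE (Rset_notT kR)) kR.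
  case: ifPn => // jR; rewrite (recurrent_Pmx_eq0 hS)//.
  by apply: contra jR; exact: recurrent_Rset hS.
rewrite big1// => k _.
have [kS|kS] := boolP (k \in S); last by rewrite entry_notin// !mul0r.
by rewrite (negbTE (Rset_notT (recurrent_Rset hS kS))) mulr0.
Qed.

(** On the extended transient part, every copy takes the value [c], the mean of [v] under mu_T,
    because it restarts there; then [v - c] is harmonic for P_T and vanishes on T. On a recurrent
    class [v] is constant by the minimum principle. *)
Lemma Mhat_harmonic (v : Vhat W -> R) :
  (forall x, \sum_z Mhat x z * v z = v x) ->
  forall x : Vhat W, \sum_z limit_kernel (val x) (val z) * v z = v x.
Proof.
(* [v] extended by 0 to copies that do not exist, so that [sum_Vhat] applies. *)
pose g s := odflt 0 (omap v (insub s)).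
have gE x : v x = g (val x) by rewrite /g valK.
have sumg (f : 'I_N + 'I_N -> R) : \sum_(z : Vhat W) f (val z) * v z =
    \sum_(z : Vhat W) (fun s => f s * g s) (val z).
  by apply: eq_bigr => z _; rewrite gE.
move=> vh; have gh (x : Vhat W) : \sum_j Mraw (val x) (inl j) * g (inl j) +
    (if T != finset.set0 then \sum_(j in ~: T) Mraw (val x) (inr j) * g (inr j)
     else 0) = g (val x).
  by rewrite -gE -vh -(sum_Vhat (fun s => Mraw (val x) s * g s)) -sumg.
pose c := \sum_j uT j * g (inl j).
have gT : T != finset.set0 -> (forall j, j \notin T -> g (inr j) = c) /\
                             (forall j, j \in T -> g (inl j) = c).
  move=> T0; have gc j : j \notin T -> g (inr j) = c.
    move=> jT; have jV : in_Vhat W (inr j) by rewrite /= T0 setC_Tset.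
    have /= <- := gh (MkVhat jV); rewrite T0 [X in _ + X]big1 ?addr0// => k _.
    by rewrite mul0r.
  split => // j jT; apply/eqP; rewrite -subr_eq0; apply/eqP.
  move: j jT; apply: (Tset_eq0_principle W_ge0 (v := fun j => g (inl j) - c)).
  move=> i iT; have := gh (node W i); rewrite /= iT T0 => <-.
  (* The row of [i] has mass 1, so [c] splits between T and the copies; the part on the copies
     cancels, since [g] equals [c] there. *)
  have cE : (\sum_(j in T) p i j) * c + (\sum_(j in ~: T) p i j) * c = c.
    rewrite -mulrDl (eq_bigl _ _ (fun j => finset.in_setC j T)).
    by rewrite -(bigID (mem T) xpredT) Pmx_sum ?mul1r// Tset_notD.
  under eq_bigr do rewrite mulrBr; rewrite sumrB -mulr_suml.
  rewrite [X in _ = _ + X - _](_ : _ = (\sum_(j in ~: T) p i j) * c); last first.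
    rewrite mulr_suml; apply: eq_bigr => j.
    by rewrite finset.in_setC => jT; rewrite gc.
  rewrite -[in X in _ = _ - X]cE opprD addrA [in RHS]addrAC addrK; congr (_ - _).
  rewrite [LHS]big_mkcond; apply: eq_bigr => j _; case: ifP => //.
  by rewrite mul0r.
have limT : T != finset.set0 -> \sum_z limit_T (val z) * v z = c.
  move=> T0; have [gR gT'] := gT T0.
  rewrite sumg; transitivity (\sum_(z : Vhat W) limit_T (val z) * c); last first.
    by rewrite -mulr_suml limit_T_sum// mul1r.
  apply: eq_bigr => -[[j|j] zV] _ /=; last first.
    by rewrite gR// -setC_Tset; case/andP: zV.
  have [jT|jT] := boolP (j \in T); first by rewrite gT'.
  by rewrite [lam j]entry_notin// !mul0r.
case=> -[i|i] xV /=; last first.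
  have /andP[T0 iT] := xV; rewrite limT// gE/=.
  by have [-> //] := gT T0; rewrite -setC_Tset.
have [iT|iT] := boolP (i \in T).
  have T0 : T != finset.set0 by apply/finset.set0Pn; exists i.
  by rewrite limT// gE /=; have [_ ->] := gT T0.
have [/RsetP[S hS iS]|iR] := boolP (i \in Rset W); last first.
  rewrite (bigD1 (MkVhat xV))//= eqxx mul1r big1 ?addr0// => z zi.
  have -> : (inl i == val z) = false.
    apply: contraNF zi => /eqP zi; apply/eqP/val_inj.
    by rewrite -zi.
  by rewrite mul0r.
have uh k : k \in S -> \sum_j p k j * g (inl j) = g (inl k).
  move=> kS; have kR := recurrent_Rset hS kS.
  have /= <- := gh (node W k); rewrite (negbTE (Rset_notT kR)) kR.
  rewrite [X in _ = _ + X](_ : _ = 0) ?addr0; last first.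
    by case: ifP => // _; rewrite big1// => l _; rewrite mul0r.
  apply: eq_bigr => j _; case: ifPn => // jR.
  rewrite (recurrent_Pmx_eq0 hS)//.
  by apply: contra jR; exact: recurrent_Rset hS.
rewrite (sumg (fun s => if s is inl j then limit_rec i j else 0)).
rewrite (sum_Vhat (fun s => (if s is inl j then limit_rec i j else 0) * g s)) /=.
rewrite [X in _ + X](_ : _ = 0) ?addr0; last first.
  by case: ifP => // _; rewrite big1// => k _; rewrite mul0r.
rewrite gE /= -[RHS]mul1r -(lambda_rec_sum hS) mulr_suml.
apply: eq_bigr => j _; rewrite (limit_recE _ hS iS).
have [jS|jS] := boolP (j \in S); last by rewrite entry_notin// !mul0r.
by rewrite (recurrent_harmonic_const W_ge0 hS uh jS iS).
Qed.

End LimitKernel.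

(** * Finite Markov chains *)

Section FiniteFibers.
Context {d} {O : measurableType d} {R : realType} (P : probability O R).

Definition pr (A : set O) : R := fine (P A).

Lemma prE A : measurable A -> P A = (pr A)%:E.
Proof. by move=> mA; rewrite fineK// fin_num_measure. Qed.

Lemma pr_ge0 A : 0 <= pr A.
Proof. exact/fine_ge0/measure_ge0. Qed.

Lemma pr_le A B : measurable A -> measurable B -> A `<=` B -> pr A <= pr B.
Proof.
move=> mA mB AB; rewrite -lee_fin -!prE//.
by apply: le_measure => //; rewrite inE.
Qed.

Lemma pr_le1 A : measurable A -> pr A <= 1.
Proof. by move=> mA; rewrite -lee_fin -prE// probability_le1. Qed.

Lemma pr0 : pr set0 = 0. Proof. by rewrite /pr measure0. Qed.

Context {I : finType} (Z : O -> I).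
Hypothesis mZ : forall i, measurable (Z @^-1` [set i]).

Lemma measurable_preimage_fin A : measurable (Z @^-1` A).
Proof.
rewrite [X in measurable X](_ : _ = \bigcup_(i in A) Z @^-1` [set i]).
  by apply: fin_bigcup_measurable => // i _; exact: finite_finset.
by apply/seteqP; split => [w Aw|w [i Ai /= ->]]//; exists (Z w).
Qed.

Lemma pr_sum_fibers A : measurable A ->
  pr A = \sum_i pr (A `&` Z @^-1` [set i]).
Proof.
move=> mA; have mAZ i : measurable (A `&` Z @^-1` [set i]) by exact: measurableI.
apply: EFin_inj; rewrite -prE// -sumEFin.
under eq_bigr do rewrite -prE//.
rewrite fsbig_seq ?index_enum_uniq// -measure_fin_bigcup//.
- congr (P _); rewrite -setI_bigcupr; apply/seteqP; split => [w Aw|w []//].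
  by split => //; exists (Z w) => //=; rewrite mem_index_enum.
- by move=> i j _ _ [w [[_ /= <-] [_ /= <-]]].
Qed.

End FiniteFibers.

Section Chain.
Context {d} {O : measurableType d} {R : realType} (P : probability O R).
Context {S : finType} (X : nat -> O -> S) (init : S -> R) (M : S -> S -> R).
Hypothesis X_markov : markov_chain P X init M.
Local Notation pr := (pr P).

Lemma measurable_state n (A : set S) : measurable (X n @^-1` A).
Proof. by have [mX _ _] := X_markov; exact: measurable_preimage_fin. Qed.

(* [H] is an event on the first n+1 states. *)
Definition past n (H : set O) := forall w w',
  (forall k, (k <= n)%N -> X k w = X k w') -> H w -> H w'.

Definition trajectory n (w : O) : {ffun 'I_n.+1 -> S} := [ffun k : 'I_n.+1 => X k w].

Lemma trajectory_eqP n w w' :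
  trajectory n w = trajectory n w' <-> (forall k, (k <= n)%N -> X k w = X k w').
Proof.
split => [/ffunP h k kn|h].
  by have := h (Ordinal (kn : (k < n.+1)%N)); rewrite !ffunE.
by apply/ffunP => k; rewrite !ffunE h// -ltnS.
Qed.

Lemma measurable_trajectory n f : measurable (trajectory n @^-1` [set f]).
Proof.
rewrite [X in measurable X](_ : _ =
    \bigcap_(k in [set: 'I_n.+1]) X k @^-1` [set f k]).
  apply: fin_bigcap_measurable => [|k _]; first exact: finite_finset.
  exact: measurable_state.
apply/seteqP; split => [w /= <- k _ /=|w /= wf]; first by rewrite ffunE.
by apply/ffunP => k; rewrite ffunE; exact: wf.
Qed.

(** Such an event is a union of fibers of [trajectory n], which takes finitely many values. *)
Lemma measurable_past n H : past n H -> measurable H.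
Proof.
move=> pH; rewrite (_ : H = trajectory n @^-1` (trajectory n @` H)).
  exact: (measurable_preimage_fin (@measurable_trajectory n)).
apply/seteqP; split => [w Hw|w [w' Hw' /trajectory_eqP]]; first by exists w.
by move/pH; exact.
Qed.

(** [markov_chain] speaks only of complete histories of positive probability. Any event of the past
    is decomposed into histories, and the identity is summed over them. *)
Lemma past_next n H x y : past n H ->
  pr (H `&` [set w | X n w = x] `&` [set w | X n.+1 w = y]) =
  pr (H `&` [set w | X n w = x]) * M x y.
Proof.
move=> pH; set E := H `&` _; set F := [set w | X n.+1 w = y].
have mE : measurable E.
  by apply: measurableI; [exact: measurable_past pH|exact: (measurable_state n [set x])].
have mF : measurable F by exact: (measurable_state n.+1 [set y]).
rewrite (pr_sum_fibers _ (@measurable_trajectory n) mE).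
rewrite (pr_sum_fibers _ (@measurable_trajectory n) (measurableI _ _ mE mF)).
rewrite mulr_suml; apply: eq_bigr => f _.
(* If the fiber meets [E], it is the history [C] of a representative [w0]; otherwise both sides
   vanish. *)
have [[w0 [Ew0 fw0]]|nE] := pselect (E `&` trajectory n @^-1` [set f] !=set0); last first.
  have E0 : E `&` trajectory n @^-1` [set f] = set0.
    by rewrite -subset0 => w Ew; apply: nE; exists w.
  by rewrite setIAC E0 set0I pr0 mul0r.
pose C := [set w | forall k, (k <= n)%N -> X k w = X k w0].
have CE : C = E `&` trajectory n @^-1` [set f].
  apply/seteqP; split => [w Cw|w [_ /= fw]]; last first.
    by apply/trajectory_eqP; rewrite fw -fw0.
  split; last by rewrite /= -fw0; exact/trajectory_eqP.
  split; last by rewrite /= Cw//; have [] := Ew0.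
  by have [Hw0 _] := Ew0; apply: pH Hw0 => k kn; rewrite Cw.
have mC : measurable C.
  by rewrite CE; apply: measurableI => //; exact: measurable_trajectory.
rewrite setIAC -CE.
have [_ _ /(_ n (fun k => X k w0) y)] := X_markov.
(* A null history gives 0 on both sides; the Markov property covers the others. *)
rewrite -/C => h; have [C0|C0] := eqVneq (pr C) 0.
  rewrite C0 mul0r; apply/eqP; rewrite eq_le pr_ge0 andbT -C0 pr_le//.
  exact: measurableI.
have /h : (0 < P C)%E by rewrite (prE P mC) lte_fin lt_neqAle eq_sym C0 pr_ge0.
have [_ /= ->] := Ew0.
by rewrite /cprob setIC -/F => <-; rewrite mulrC divfK.
Qed.

Lemma pr_init x : pr [set w | X 0%N w = x] = init x.
Proof.
have [_ h _] := X_markov; apply: EFin_inj; rewrite -prE ?h//.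
exact: (measurable_state 0 [set x]).
Qed.

Lemma pr_step n y :
  pr [set w | X n.+1 w = y] = \sum_x pr [set w | X n w = x] * M x y.
Proof.
have mX k z : measurable [set w | X k w = z] := measurable_state k [set z].
rewrite (pr_sum_fibers P (mX n) (mX n.+1 y)); apply: eq_bigr => x _.
by have := @past_next n setT x y; rewrite !setTI => <- //; rewrite setIC.
Qed.

(** The probability, from [x], of visiting the sets of [As] one after the other. The last set is
    still followed by a free step, whose total weight is a row sum of [M]. *)
Fixpoint follow_prob (As : seq {set S}) (x : S) : R :=
  if As is A :: As' then (x \in A)%:R * \sum_y M x y * follow_prob As' y else 1.

Fixpoint follow (t : nat) (As : seq {set S}) (w : O) : Prop :=
  if As is A :: As' then X t w \in A /\ follow t.+1 As' w else True.

Lemma followP t As w : follow t As w <->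
  (forall k, (k < size As)%N -> X (t + k) w \in nth finset.set0 As k).
Proof.
elim: As t => [|A As IH] t //=; split => [[XA /IH h] [|k]|h].
- by rewrite addn0.
- by rewrite ltnS addnS -addSn => /h.
- split; first by have := h 0%N isT; rewrite addn0.
  by apply/IH => k kA; have := h k.+1 kA; rewrite addnS -addSn.
Qed.

Lemma follow_cat t As Bs w :
  follow t (As ++ Bs) w <-> follow t As w /\ follow (t + size As) Bs w.
Proof.
elim: As t => [|A As IH] t /=; first by rewrite addn0; split => [|[]].
by rewrite IH addSnnS; tauto.
Qed.

Lemma measurable_follow t As : measurable (follow t As).
Proof.
elim: As t => [|A As IH] t /=; first exact: measurableT.
by apply: (measurableI _ _ (measurable_state t [set` A]) (IH t.+1)).
Qed.

(** Induction on the pattern with [H] general: fixing the state at time [t] enlarges [H] to an event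
    of the past at time [t.+1]. *)
Lemma pr_follow t H As x : past t H ->
  pr (H `&` [set w | X t w = x] `&` follow t As) =
  pr (H `&` [set w | X t w = x]) * follow_prob As x.
Proof.
have mX k z : measurable [set w | X k w = z] := measurable_state k [set z].
elim: As t H x => [|A As IH] t H x pH /=; first by rewrite setIT mulr1.
have mE : measurable (H `&` [set w | X t w = x]).
  by apply: measurableI => //; exact: measurable_past pH.
have [xA|xA] := boolP (x \in A); last first.
  rewrite mul0r mulr0 (_ : _ `&` _ = set0) ?pr0//.
  by rewrite -subset0 => w [[_ /= ->]] [xA' _]; rewrite xA' in xA.
rewrite mul1r (_ : _ `&` _ = (H `&` [set w | X t w = x]) `&` follow t.+1 As); last first.
  by apply/seteqP; split => [w [? []]|w [[? /= Xx] ?]]//; split=> //; rewrite /= Xx.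
rewrite (pr_sum_fibers P (mX t.+1)); last exact/measurableI/measurable_follow.
rewrite mulr_sumr; apply: eq_bigr => y _.
rewrite (setIAC (H `&` _)) (IH t.+1 (H `&` [set w | X t w = x]) y); last first.
  move=> w w' ww' [Hw Xw].
  split; last by rewrite /= -ww'.
  by apply: pH Hw => k kt; rewrite ww'// ltnW.
by rewrite past_next// mulrA.
Qed.

End Chain.

(** * Occupation times *)

Section Occupation.
Context {d} {O : measurableType d} {R : realType} (P : probability O R).
Context {S : finType} (X : nat -> O -> S) (init : S -> R) (M : S -> S -> R).
Hypothesis X_markov : markov_chain P X init M.
Local Notation pr := (pr P).

Lemma pr_state_in n (V : {set S}) :
  pr [set w | X n w \in V] = \sum_(y in V) pr [set w | X n w = y].
Proof.
have mX A : measurable (X n @^-1` A) by exact: (measurable_state X_markov).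
rewrite (pr_sum_fibers P (fun y => mX [set y]) (mX [set` V])) [RHS]big_mkcond.
apply: eq_bigr => y _; case: ifPn => yV.
  by congr pr; apply/seteqP; split => [w []|w /= ->].
by rewrite (_ : _ `&` _ = set0) ?pr0// -subset0 => w [/= + Xy]; rewrite Xy (negbTE yV).
Qed.

Lemma occupation_sum n (V : {set S}) :
  (\sum_i (init i)%:E *
     cexp P (fun w => (\sum_(0 <= nu < n) \1_[set w' | X nu w' \in V] w)%:E)
       [set w | X 0%N w = i] =
   (\sum_(0 <= nu < n) \sum_(y in V) pr [set w | X nu w = y])%:E)%E.
Proof.
have mV k : measurable [set w | X k w \in V].
  exact: (measurable_state X_markov k [set` V]).
have mi i : measurable [set w | X 0%N w = i].
  exact: (measurable_state X_markov 0 [set i]).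
transitivity (\sum_i (\sum_(0 <= nu < n)
    pr ([set w | X nu w \in V] `&` [set w | X 0%N w = i]))%:E)%E; last first.
  rewrite sumEFin; congr _%:E; rewrite exchange_big; apply: eq_bigr => nu _.
  by rewrite -pr_state_in (pr_sum_fibers P mi).
apply: eq_bigr => i _; rewrite /cexp -/(pr _) (pr_init X_markov).
under eq_integral do rewrite -sumEFin.
rewrite ge0_integral_sum//; last first.
  by move=> k; apply/measurable_EFinP; exact: measurable_indic.
rewrite (eq_bigr (fun k =>
  (pr ([set w | X k w \in V] `&` [set w | X 0%N w = i]))%:E)) => [|k _]; last first.
  by rewrite integral_indic//; apply: prE; exact: measurableI.
rewrite sumEFin -!EFinM; congr _%:E.
(* For [init i = 0] the weight kills the left side, and on the right the event lies in a null
   set. *)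
have [i0|i0] := eqVneq (init i) 0; last by rewrite mulVKf.
rewrite i0 mul0r big1// => k _; apply/eqP; rewrite eq_le pr_ge0 andbT.
rewrite -i0 -(pr_init X_markov) pr_le//.
exact: measurableI.
Qed.

End Occupation.

(** * PureRank as the mean of the limit kernel *)

Section PureRankLimit.
Context {R : realType} {N : nat} (W : 'M[R]_N).
Hypothesis W_ge0 : forall i j, 0 <= W i j.
Local Notation p := (Pmx W).
Local Notation D := (Dset W).
Local Notation T := (Tset W).
Local Notation lam := (entry (lambda_T W)).

Lemma sum_node_pair (h : 'I_N + 'I_N -> R) j :
  \sum_(y in node_pair W j) h (val y) =
  h (inl j) + (if in_Vhat W (inr j) then h (inr j) else 0).
Proof.
rewrite big_mkcond /=.
pose g s := if (s == inl j) || (s == inr j) then h s else 0.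
rewrite (eq_bigr (fun y : Vhat W => g (val y))) => [|y _]; last by rewrite inE.
have gl k : g (inl k) = if k == j then h (inl k) else 0.
  by rewrite /g orbF (inj_eq inl_inj).
have gr k : g (inr k) = if k == j then h (inr k) else 0.
  by rewrite /g orFb (inj_eq inr_inj).
rewrite sum_Vhat; under eq_bigr do rewrite gl.
rewrite -big_mkcond big_pred1_eq; congr (_ + _); rewrite /in_Vhat setC_Tset.
case: (T != finset.set0) => //=; under eq_bigr do rewrite gr.
rewrite -big_mkcondr; have [jT|jT] := boolP (j \in T).
  rewrite big_pred0// => k; rewrite finset.in_setC; apply/negbTE/negP.
  by move=> /andP[+ /eqP kj]; rewrite kj jT.
rewrite (big_pred1 j)// => k; rewrite finset.in_setC/= andb_idl//.
by move=> /eqP ->.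
Qed.

(** Each of the [#|S|] starting nodes in a class [S] contributes the same [lambda_rec W S]. *)
Lemma sum_limit_rec j : \sum_(i in Rset W) limit_rec W i j =
  \sum_(S in rec_classes W) #|S|%:R * entry (lambda_rec W S) j.
Proof.
rewrite exchange_big /=; apply: eq_bigr => S SR; rewrite -mulr_suml; congr (_ * _).
rewrite (eq_bigr (fun i => if i \in S then 1 else 0)); last first.
  by move=> i _; case: ifP.
rewrite -big_mkcondr -sumr_const; apply: eq_bigl => i.
rewrite andb_idl// => iS; apply: recurrent_Rset iS; exact/rec_classesP.
Qed.

Lemma sum_rec_classes_in j :
  \sum_(S in rec_classes W) (j \in S)%:R = (j \in Rset W)%:R :> R.
Proof.
have [/RsetP[S /rec_classesP SR jS]|jR] := boolP (j \in Rset W).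
  rewrite (bigD1 S)//= jS big1 ?addr0// => S' /andP[S'R S'S].
  have [jS'|//] := boolP (j \in S').
  by rewrite (rec_classes_inj W_ge0 S'R SR jS' jS) eqxx in S'S.
rewrite big1// => S /rec_classesP hS; have [jS|//] := boolP (j \in S).
by rewrite (recurrent_Rset hS jS) in jR.
Qed.

(** Of the N equally likely starting nodes, the |T| transient ones contribute [limit_T], those of a
    class its stationary distribution, and dangling ones themselves. The node j thus collects the
    local importance terms, and its copy collects the flow lambda_T P out of T. *)
Lemma PureRank_limit j :
  \sum_(y in node_pair W j)
    \sum_(x : Vhat W) varpi x * limit_kernel W (val x) (val y) = PureRank W j.
Proof.
pose h t := N%:R^-1 * \sum_i limit_kernel W (inl i) t.
have hE t : \sum_(x : Vhat W) varpi x * limit_kernel W (val x) t = h t.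
  rewrite (sum_Vhat W (fun s => (if s is inl _ then N%:R^-1 else 0) *
                              limit_kernel W s t)).
  rewrite /h mulr_sumr [X in _ + X](_ : _ = 0) ?addr0//.
  by case: ifP => // _; rewrite big1// => i _; rewrite mul0r.
under eq_bigr do rewrite hE.
rewrite sum_node_pair {hE}/h.
pose q := #|T|%:R / (1 + theta_T W).
pose s := \sum_i lam i * p i j.
have sumT (a b : 'I_N -> R) : \sum_i (if i \in T then a i else b i) =
    \sum_(i in T) a i + \sum_(i in ~: T) b i.
  rewrite (bigID (mem T))/=; congr (_ + _).
    by apply: eq_bigr => i ->.
  under [RHS]eq_bigl do rewrite finset.in_setC.
  by apply: eq_bigr => i /negbTE ->.
have -> : \sum_i limit_kernel W (inl i) (inl j) = q * lam j +
    (\sum_(S in rec_classes W) #|S|%:R * entry (lambda_rec W S) j + (j \in D)%:R).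
  rewrite sumT sumr_const -[_ *+ #|_|]mulr_natl /q [limit_T _ _]/=; congr (_ + _).
    by rewrite /limit_T; ring.
  rewrite -sum_limit_rec.
  rewrite (eq_bigl (fun i => (i \in Rset W) || (i \in D))) => [|i]; last first.
    by rewrite -finset.in_setU setC_Tset finset.in_setC.
  rewrite (bigID (mem (Rset W)))/=; congr (_ + _).
    by apply: eq_big => [i|i /andP[_ ->]]//; case: (i \in Rset W); rewrite ?andbF.
  rewrite (eq_bigl (mem D)) => [|i]; last first.
    have [iR|iR] := boolP (i \in Rset W); rewrite ?andbT ?andbF//=.
    by apply/esym/negbTE/Rset_notD.
  have [jD|jD] := boolP (j \in D).
    rewrite (bigD1 j)//= eqxx; have [jR|jR] := boolP (j \in Rset W).
      by have := Rset_notD jR; rewrite jD.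
    rewrite big1 ?addr0// => i /andP[iD ij].
    have [iR|iR] := boolP (i \in Rset W).
      by have := Rset_notD iR; rewrite [i \in D]iD.
    by rewrite (inj_eq inl_inj) (negbTE ij).
  rewrite big1// => i iD.
  have [iR|iR] := boolP (i \in Rset W); first by have := Rset_notD iR; rewrite [i \in D]iD.
  by rewrite (inj_eq inl_inj); case: eqVneq jD => // <-; rewrite [i \in D]iD.
(* The copy is missing either for [j] in T, matched by the last factor, or for T empty, where [q] is
   0. *)
have -> : (if in_Vhat W (inr j) then
      N%:R^-1 * \sum_i limit_kernel W (inl i) (inr j) else 0) =
    N%:R^-1 * (q * s * (j \notin T)%:R).
  have [T0|T0] := eqVneq T finset.set0.
    by rewrite /in_Vhat T0 eqxx/= /q T0 cards0 !mul0r mulr0.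
  rewrite /in_Vhat T0 setC_Tset/=; case: ifPn; rewrite ?mulr0// => jT.
  rewrite sumT sumr_const -[_ *+ #|_|]mulr_natl /q /= -/s mulr1; congr (_ * _).
  rewrite big1 ?addr0; first by ring.
  by move=> i _; case: ifP.
(* The common shape of [pi_rec] and [pi_D]. *)
have piE (S : {set 'I_N}) (v : 'rV[R]_#|S|) a :
    entry (N%:R^-1 *: (a *: v + q *: (lambda_T W *m sub_mx p T S))) j =
    N%:R^-1 * (a * entry v j) + N%:R^-1 * (q * s) * (j \in S)%:R.
  rewrite entryZ entryD [entry (a *: v) _]entryZ [entry (q *: _) _]entryZ.
  rewrite mulrDr -!mulrA; have [jS|jS] := boolP (j \in S).
    by rewrite entry_mul// mulr1.
  by rewrite [entry (_ *m _) j]entry_notin// !mulr0.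
rewrite /PureRank /pi_D /pi_T piE -/q [entry (_ *: (q *: lambda_T W)) _]entryZ.
rewrite [entry (q *: lambda_T W) _]entryZ.
rewrite [X in _ = X + _ + _](eq_bigr (fun S : {set 'I_N} =>
    N%:R^-1 * (#|S|%:R * entry (lambda_rec W S) j) +
    N%:R^-1 * (q * s) * (j \in S)%:R)) => [|S SR]; last exact: piE.
rewrite big_split /= -!mulr_sumr sum_rec_classes_in entry_unif.
have -> : (j \notin T)%:R = (j \in Rset W)%:R + (j \in D)%:R :> R.
  rewrite -setC_Tset finset.in_setU; case: (boolP (j \in Rset W)) => [jR|_].
    by rewrite (negbTE (Rset_notD jR)) addr0.
  by rewrite add0r.
have -> : #|D|%:R * ((j \in D)%:R / #|D|%:R) = (j \in D)%:R :> R.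
  have [jD|jD] := boolP (j \in D); last by rewrite mul0r mulr0.
  by rewrite mul1r mulfV// pnatr_eq0 -lt0n; apply/card_gt0P; exists j.
by ring.
Qed.

Context {d} {O : measurableType d} (P : probability O R) (X : nat -> O -> Vhat W).
Hypothesis X_markov : markov_chain P X (@varpi R N W) (@Mhat R N W).

Lemma PureRank_cvg j :
  (fun n : nat => (n%:R^-1)%:E *
     \sum_(i : Vhat W) (varpi i)%:E *
       cexp P (fun w => (\sum_(0 <= nu < n)
                           \1_[set w' | X nu w' \in node_pair W j] w)%:E)
              [set w | X 0%N w = i])%E @ \oo
    --> (PureRank W j)%:E.
Proof.
under eq_fun do rewrite (occupation_sum X_markov) -EFinM.
apply: cvg_EFin; first exact: nearW.
rewrite -PureRank_limit.
under eq_fun do rewrite /= exchange_big mulr_sumr.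
apply: cvg_big => [|y _]; first exact: add_continuous.
have := @cesaro_cvg _ _ (@Mhat R N W) (fun x y => limit_kernel W (val x) (val y))
  _ _ _ (fun n x => pr P [set w | X n w = x]) y.
rewrite (eq_bigr (fun x : Vhat W => varpi x * limit_kernel W (val x) (val y))).
  apply.
  - exact: limit_kernel_Mhat.
  - exact: Mhat_limit_kernel.
  - exact: Mhat_harmonic.
  - move=> n x; rewrite pr_ge0 pr_le1//.
    exact: (measurable_state X_markov n [set x]).
  - exact: (pr_step X_markov).
by move=> x _; rewrite (pr_init X_markov).
Qed.

End PureRankLimit.

(** * The law of a sojourn in T *)

Section SojournLaw.
Context {R : realType} {N : nat} (W : 'M[R]_N).
Hypothesis W_ge0 : forall i j, 0 <= W i j.
Local Notation p := (Pmx W).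
Local Notation T := (Tset W).
Local Notation TV := (T_in_Vhat W).
Local Notation CV := (copies W).
Local Notation M := (@Mhat R N W).
Local Notation follow_prob := (follow_prob M).
Hypothesis T0 : T != finset.set0.

Definition restart (x : Vhat W) : R :=
  if val x is inl j then entry (unif T) j else 0.

Lemma sum_restart (f : Vhat W -> R) :
  \sum_x restart x * f x = \sum_j entry (unif T) j * f (node W j).
Proof.
pose g s := (if s is inl j then entry (unif T) j else 0) *
            odflt 0 (omap f (insub s)).
rewrite (eq_bigr (fun x : Vhat W => g (val x))) => [|x _]; last by rewrite /g valK.
rewrite sum_Vhat T0 [X in _ + X]big1 ?addr0 => [|i _]; last by rewrite /g mul0r.
by apply: eq_bigr => j _; rewrite /g -[inl j]/(val (node W j)) valK.
Qed.

Lemma restart_sum : \sum_x restart x = 1.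
Proof.
under eq_bigr do rewrite -[restart _]mulr1.
rewrite (sum_restart (fun=> 1)); under eq_bigr do rewrite mulr1.
exact: sum_unif.
Qed.

Lemma restart_ge0 x : 0 <= restart x.
Proof. by rewrite /restart; case: (val x) => // j; exact: unif_ge0. Qed.

Lemma mem_TV j : (node W j \in TV) = (j \in T).
Proof. by rewrite inE. Qed.

Lemma restart_eq0 x : x \notin TV -> restart x = 0.
Proof.
by rewrite inE /restart; case: (val x) => // j jT; rewrite entry_notin.
Qed.

Lemma TV_CV x : x \in TV -> x \in CV = false.
Proof. by rewrite !inE; case: (val x). Qed.

Lemma Mhat_copies x y : x \in CV -> M x y = restart y.
Proof. by rewrite inE MhatE /restart; case: (val x) => // i _; case: (val y). Qed.

Lemma Mhat_TV x y : x \in TV -> M x y != 0 -> (y \in TV) || (y \in CV).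
Proof.
rewrite !inE MhatE; case: (val x) => // i iT.
case: (val y) => j; rewrite /= iT ?orbT ?orbF//.
by case: ifP => //; rewrite eqxx.
Qed.

Lemma follow_prob_ge0 As x : 0 <= follow_prob As x.
Proof.
elim: As x => //= A As IH x; rewrite mulr_ge0//.
by apply: sumr_ge0 => y _; rewrite mulr_ge0// Mhat_ge0.
Qed.

Definition sojourn_pattern (c : nat) : seq {set Vhat W} := nseq c TV ++ [:: CV].

(** For [c > 0] this is mu_T P_T^(c-1) (I - P_T) e, a discrete phase-type distribution; [law 0] is
    0, since a restart lands in T. *)
Definition law (c : nat) : R :=
  \sum_x restart x * follow_prob (sojourn_pattern c) x.

(** For [x] in T and [n > 0] this is the entry at [x] of P_T^(n-1) e, whence the index [k.+1] in the
    series below. *)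
Definition survival (n : nat) (x : Vhat W) : R := follow_prob (nseq n TV) x.

Lemma law_ge0 c : 0 <= law c.
Proof. by apply: sumr_ge0 => x _; rewrite mulr_ge0 ?restart_ge0 ?follow_prob_ge0. Qed.

(* The step out of a copy restarts the chain from [restart]. *)
Lemma follow_prob_sojourn c As x :
  follow_prob (sojourn_pattern c ++ As) x =
  follow_prob (sojourn_pattern c) x * \sum_y restart y * follow_prob As y.
Proof.
elim: c x => [|c IH] x /=.
  have [xC|xC] := boolP (x \in CV); last by rewrite !mul0r.
  rewrite !mul1r [X in _ = X * _](_ : _ = 1).
    by rewrite mul1r; apply: eq_bigr => y _; rewrite Mhat_copies.
  by under eq_bigr do rewrite mulr1; rewrite Mhat_sum.
rewrite -mulrA mulr_suml; congr (_ * _); apply: eq_bigr => y _.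
by rewrite IH mulrA.
Qed.

Lemma law_pattern cs :
  \sum_x restart x * follow_prob (flatten (map sojourn_pattern cs)) x =
  \prod_(c <- cs) law c.
Proof.
elim: cs => [|c cs IH] /=.
  by under eq_bigr do rewrite mulr1; rewrite big_nil restart_sum.
under eq_bigr do rewrite follow_prob_sojourn mulrA.
by rewrite -mulr_suml IH big_cons.
Qed.

(** From T the chain moves only to T or to a copy, so either a copy is met among the first [n]
    states or all of them lie in T. *)
Lemma sum_follow_sojourn n x : (x \in TV) || (x \in CV) ->
  \sum_(0 <= c < n) follow_prob (sojourn_pattern c) x = 1 - survival n x.
Proof.
elim: n x => [|n IH] x xTC; first by rewrite big_nil subrr.
rewrite big_nat_recl//=; have [xT|xT] := boolP (x \in TV).
  rewrite TV_CV// mul0r add0r /survival /= xT mul1r.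
  under eq_bigr do rewrite mul1r.
  rewrite exchange_big -(Mhat_sum W_ge0 x) -sumrB; apply: eq_bigr => y _.
  rewrite -mulr_sumr; have [->|Mxy] := eqVneq (M x y) 0; first by rewrite !mul0r subrr.
  by rewrite IH ?(Mhat_TV xT)// mulrBr mulr1.
move: xTC; rewrite (negbTE xT)/= => xC; rewrite xC mul1r.
rewrite /survival /= (negbTE xT) mul0r subr0.
under eq_bigr do rewrite mulr1.
rewrite Mhat_sum// big1 ?addr0// => c _.
by rewrite mul0r.
Qed.

(** The probability that a sojourn has length at least [n]. *)
Definition tail (n : nat) : R := \sum_x restart x * survival n x.

Lemma sum_law n : \sum_(0 <= c < n) law c = 1 - tail n.
Proof.
rewrite exchange_big /= -restart_sum -sumrB; apply: eq_bigr => x _.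
rewrite -mulr_sumr; have [xT|xT] := boolP (x \in TV).
  by rewrite sum_follow_sojourn ?xT// mulrBr mulr1.
by rewrite restart_eq0// !mul0r subrr.
Qed.

Lemma survival_series n i : i \in T ->
  \sum_(0 <= k < n.+1) survival k.+1 (node W i) =
  1 + \sum_(j in T) p i j * \sum_(0 <= k < n) survival k.+1 (node W j).
Proof.
move=> iT; have step k :
    survival k.+1 (node W i) = \sum_y M (node W i) y * survival k y.
  by rewrite /survival /= mem_TV iT mul1r.
rewrite big_nat_recl// step; congr (_ + _).
  by under eq_bigr do rewrite mulr1; rewrite Mhat_sum.
under eq_bigr do rewrite step; rewrite exchange_big /=.
under eq_bigr do rewrite -mulr_sumr.
pose g s := Mraw W (inl i) s *
  odflt 0 (omap (fun y : Vhat W => \sum_(0 <= k < n) survival k.+1 y) (insub s)).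
rewrite (eq_bigr (fun y : Vhat W => g (val y))) => [|y _]; last by rewrite /g valK.
have survC k (y : Vhat W) : y \notin TV -> survival k.+1 y = 0.
  by move=> yT; rewrite /survival /= (negbTE yT) mul0r.
rewrite sum_Vhat T0 [X in _ + X]big1 ?addr0 => [|j jT]; last first.
  rewrite /g; case: insubP => [y _ yj|_]; last by rewrite mulr0.
  rewrite /= [X in _ * X]big1 ?mulr0// => k _.
  by rewrite survC// inE yj.
rewrite [RHS]big_mkcond; apply: eq_bigr => j _.
rewrite /g -[inl j]/(val (node W j)) valK /= iT.
by case: ifP => // _; rewrite mul0r.
Qed.

(** The Neumann series of P_T applied to e. Its partial sums increase and stay below [sojourn] by
    the common first-step recursion; the limit solves the same equation as [sojourn], and the
    solution is unique on T. *)
Lemma survival_sum_cvg i : i \in T ->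
  (fun n => \sum_(0 <= k < n) survival k.+1 (node W i)) @ \oo --> sojourn W i.
Proof.
pose s j n := \sum_(0 <= k < n) survival k.+1 (node W j).
have s_le n j : j \in T -> s j n <= sojourn W j.
  elim: n j => [|n IH] j jT.
    by rewrite /s big_nil (le_trans _ (sojourn_ge1 W_ge0 jT)).
  rewrite /s survival_series// sojourn_step// lerD2l; apply: ler_sum => k kT.
  by rewrite ler_wpM2l ?Pmx_ge0// IH.
have s_cvg j : j \in T -> cvgn (s j).
  move=> jT; apply: nondecreasing_is_cvgn; last first.
    by exists (sojourn W j) => _ [n _ <-]; exact: s_le.
  apply/nondecreasing_seqP => n; rewrite /s big_nat_recr//= lerDl.
  exact: follow_prob_ge0.
have lim_eq j : j \in T -> limn (s j) = 1 + \sum_(k in T) p j k * limn (s k).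
  move=> jT; apply/cvg_lim => //; rewrite -cvg_shiftS /=.
  under eq_fun do rewrite /s survival_series//.
  apply: cvgD; first exact: cvg_cst.
  apply: cvg_big => [|k kT]; first exact: add_continuous.
  by apply: cvgM; [exact: cvg_cst|exact: s_cvg].
move=> iT; suff -> : sojourn W i = limn (s i) by exact: s_cvg.
apply/eqP; rewrite -subr_eq0; apply/eqP; move: i iT.
apply: Tset_eq0_principle => // j jT.
rewrite [X in _ = X - _]sojourn_step// lim_eq// opprD addrACA subrr add0r.
by rewrite -sumrB; apply: eq_bigr => k _; rewrite mulrBr.
Qed.

Lemma survival_cvg0 x : survival n x @[n --> \oo] --> 0.
Proof.
rewrite -cvg_shiftS /=; have [xT|xT] := boolP (x \in TV); last first.
  rewrite (_ : (fun n => _) = fun=> 0); first exact: cvg_cst.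
  by apply/funext => n; rewrite /survival /= (negbTE xT) mul0r.
have [i iT ->] : exists2 i, i \in T & x = node W i.
  by move: xT; rewrite inE; case: x => -[]// i ? iT; exists i => //; exact/val_inj.
apply: cvg_series_cvg_0; apply/cvg_ex; exists (sojourn W i).
exact: survival_sum_cvg.
Qed.

Lemma tail_cvg0 : tail n @[n --> \oo] --> 0.
Proof.
rewrite (_ : 0 = \sum_(x : Vhat W) restart x * 0); last first.
  by rewrite big1// => x _; rewrite mulr0.
apply: cvg_big => [|x _]; first exact: add_continuous.
by apply: cvgM; [exact: cvg_cst|exact: survival_cvg0].
Qed.

Lemma tail_sum_cvg :
  (fun n => \sum_(0 <= k < n) tail k.+1) @ \oo --> mean_sojourn W.
Proof.
rewrite mean_sojournE; under eq_fun do rewrite /tail exchange_big.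
rewrite [X in X @ _](_ : _ = fun n => \sum_j entry (unif T) j *
    \sum_(0 <= k < n) survival k.+1 (node W j)); last first.
  apply/funext => n /=; rewrite -(sum_restart (fun x => \sum_(0 <= k < n) survival k.+1 x)).
  apply: eq_bigr => x _.
  by rewrite mulr_sumr.
apply: cvg_big => [|j _]; first exact: add_continuous.
have [jT|jT] := boolP (j \in T).
  by apply: cvgM; [exact: cvg_cst|exact: survival_sum_cvg].
rewrite entry_notin// mul0r; under eq_fun do rewrite mul0r.
exact: cvg_cst.
Qed.

(** The law of a sojourn length as a set function on the extended reals, where [sojourn_length]
    takes its values; all mass sits on the naturals. *)
Definition lawE (A : set (\bar R)) : \bar R :=
  (\sum_(0 <= c <oo | c \in [set c : nat | A c%:R%:E]) (law c)%:E)%E.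

Lemma lawE_setT : lawE setT = 1%E.
Proof.
have h : (1 - tail n)%:E @[n --> \oo] --> 1%E.
  apply: cvg_EFin; first exact: nearW.
  rewrite -[X in _ --> X]subr0; apply: cvgB; first exact: cvg_cst.
  exact: tail_cvg0.
apply/cvg_lim => //; rewrite (_ : (fun n => _) = fun n => (1 - tail n)%:E)//.
apply/funext => n; rewrite -sum_law -sumEFin.
by apply: eq_bigl => c; rewrite mem_set.
Qed.

Lemma lawE_ge0 A : (0 <= lawE A)%E.
Proof. by apply: nneseries_ge0 => c _ _; rewrite lee_fin law_ge0. Qed.

Lemma lawE_le1 A : (lawE A <= 1)%E.
Proof.
rewrite -lawE_setT /lawE eseries_mkcond [leRHS]eseries_mkcond.
apply: lee_nneseries => c _; first by case: ifP => //; rewrite lee_fin law_ge0.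
by rewrite [c \in [set _ | setT _]]mem_set//; case: ifP => // _; rewrite lee_fin law_ge0.
Qed.

Lemma lawE_fin A : lawE A = (fine (lawE A))%:E.
Proof.
rewrite fineK// ge0_fin_numE ?lawE_ge0//.
by rewrite (le_lt_trans (lawE_le1 A))// ltry.
Qed.

Lemma lawE_gt n : lawE [set y | (n%:R%:E < y)%E] = (tail n.+1)%:E.
Proof.
have : lawE setT = (\sum_(0 <= c < 0 + n.+1) (law c)%:E +
                    \sum_(0 + n.+1 <= c <oo) (law c)%:E)%E.
  rewrite -nneseries_split => [|k _]; last by rewrite lee_fin law_ge0.
  by apply: eq_eseriesl => c; rewrite mem_set.
rewrite lawE_setT add0n sumEFin sum_law => h.
have -> : lawE [set y | (n%:R%:E < y)%E] = (\sum_(n.+1 <= c <oo) (law c)%:E)%E.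
  rewrite eseries_cond; apply: eq_eseriesl => c.
  rewrite andTb; apply/idP/idP; first by move=> /set_mem/=; rewrite lte_fin ltr_nat.
  by move=> ?; apply/mem_set; rewrite /= lte_fin ltr_nat.
have /eqP : (1 - (1 - tail n.+1)%:E = \sum_(n.+1 <= c <oo) (law c)%:E)%E.
  by rewrite [X in (X - _)%E]h addeC addeA -EFinN -EFinD addNr add0e.
by move=> /eqP <-; rewrite -EFinB subKr.
Qed.

End SojournLaw.

(** * Almost sure path structure *)

Lemma inf_time_min (R : realType) (A : set nat) n :
  A n -> (forall k, A k -> (n <= k)%N) -> inf_time A = n%:R%:E :> \bar R.
Proof.
move=> An nA; apply/eqP; rewrite eq_le; apply/andP; split.
  by apply: ereal_inf_lbound; exists n.
by apply: le_ereal_inf_tmp => _ [k Ak <-]; rewrite lee_fin ler_nat nA.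
Qed.

(** Writes the infimum as one over all times, with +oo at the times outside [A], so that [tau] is
    measurable as a countable infimum. *)
Lemma inf_time_einfs (R : realType) (A : set nat) :
  inf_time A = einfs (fun n => if n \in A then n%:R%:E else +oo%E) 0 :> \bar R.
Proof.
apply/eqP; rewrite eq_le; apply/andP; split.
  apply: le_ereal_inf_tmp => _ [k _ <-]; case: ifPn => [/set_mem kA|_]; last exact: leey.
  by apply: ereal_inf_lbound; exists k.
apply: le_ereal_inf_tmp => _ [k Ak <-]; apply: ereal_inf_lbound.
by exists k => //; rewrite mem_set.
Qed.

Section GoodPaths.
Context {R : realType} {N : nat} (W : 'M[R]_N).
Hypothesis W_ge0 : forall i j, 0 <= W i j.
Context {d} {O : measurableType d} (P : probability O R) (X : nat -> O -> Vhat W).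
Hypothesis X_markov : markov_chain P X (@varpi R N W) (@Mhat R N W).
Local Notation T := (Tset W).
Local Notation TV := (T_in_Vhat W).
Local Notation CV := (copies W).
Local Notation M := (@Mhat R N W).
Local Notation pr := (pr P).
Local Notation follow := (follow X).
Local Notation follow_prob := (follow_prob M).
Hypothesis T0 : T != finset.set0.

Let B := [set w | X 0%N w \in TV].

Lemma measurable_state_in n (A : {set Vhat W}) : measurable [set w | X n w \in A].
Proof. exact: (measurable_state X_markov n [set` A]). Qed.

Lemma measurable_state_eq n x : measurable [set w | X n w = x].
Proof. exact: (measurable_state X_markov n [set x]). Qed.

Lemma varpi_restart x : x \in TV ->
  varpi x = #|T|%:R / N%:R * restart x.
Proof.
rewrite inE /varpi /restart; case: (val x) => // j jT.
rewrite entry_unif jT div1r mulrAC mulfV ?mul1r// pnatr_eq0 -lt0n.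
by apply/card_gt0P; exists j.
Qed.

(** Restricted to T, the initial distribution is |T|/N times the restart distribution, so the first
    sojourn has the same law as the later ones. *)
Lemma pr_B_follow_raw As : pr (B `&` follow 0 As) =
  #|T|%:R / N%:R * \sum_x restart x * follow_prob As x.
Proof.
have mf := measurable_follow X_markov 0 As.
have mB := measurable_state_in 0 TV.
rewrite (pr_sum_fibers P (measurable_state_eq 0) (measurableI _ _ mB mf)).
rewrite mulr_sumr; apply: eq_bigr => x _; rewrite mulrA.
have [xT|xT] := boolP (x \in TV); last first.
  rewrite restart_eq0// mulr0 mul0r (_ : _ `&` _ = set0) ?pr0// -subset0.
  by move=> w [[/= + _] Xx]; rewrite /B /= Xx (negbTE xT).
rewrite -varpi_restart// -(pr_init X_markov).
rewrite -[[set w | X 0%N w = x] in RHS]setTI -(pr_follow X_markov)//.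
congr pr; rewrite setTI; apply/seteqP; split => [w [[_ ?] Xx]|w [/= Xx ?]] //.
by split => //; split => //; rewrite /B /= Xx.
Qed.

Lemma pr_B : pr B = #|T|%:R / N%:R.
Proof.
have := pr_B_follow_raw [::]; rewrite setIT => ->.
by under eq_bigr do rewrite mulr1; rewrite restart_sum// mulr1.
Qed.

Lemma pr_B_gt0 : 0 < pr B.
Proof.
rewrite pr_B; have := T0; rewrite -card_gt0 => T_gt0.
rewrite divr_gt0// ltr0n//.
by rewrite (leq_trans T_gt0)// -[X in (_ <= X)%N]card_ord max_card.
Qed.

Lemma pr_B_follow As :
  pr (B `&` follow 0 As) = pr B * \sum_x restart x * follow_prob As x.
Proof. by rewrite pr_B pr_B_follow_raw. Qed.

(** Outside all these events, a path started in T alternates between finite sojourns in T and single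
    visits to a copy. *)
Definition bad n : set O :=
  [set w | M (X n w) (X n.+1 w) = 0] `|` [set w | forall k, X (n + k) w \in TV].

Lemma measurable_forbidden n : measurable [set w | M (X n w) (X n.+1 w) = 0].
Proof.
apply: (measurable_past X_markov (n := n.+1)) => w w' ww' /=.
by rewrite !ww'.
Qed.

Lemma measurable_stay n : measurable [set w | forall k, X (n + k) w \in TV].
Proof.
rewrite (_ : mkset _ = \bigcap_k [set w | X (n + k) w \in TV]).
  by apply: bigcapT_measurable => k; exact: measurable_state_in.
by apply/seteqP; split => [w h k _|w h k]; exact: h.
Qed.

Lemma measurable_bad n : measurable (bad n).
Proof. by apply: measurableU; [exact: measurable_forbidden|exact: measurable_stay]. Qed.

Lemma pr_forbidden n : pr [set w | M (X n w) (X n.+1 w) = 0] = 0.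
Proof.
have mf := measurable_forbidden n.
rewrite (pr_sum_fibers P (measurable_state_eq n) mf) big1// => x _.
have mx := measurable_state_eq n x.
rewrite (pr_sum_fibers P (measurable_state_eq n.+1) (measurableI _ _ mf mx)).
rewrite big1// => y _; have my := measurable_state_eq n.+1 y.
have [Mxy|Mxy] := eqVneq (M x y) 0; last first.
  rewrite (_ : _ `&` _ = set0) ?pr0// -subset0 => w [[/= + Xx] Xy].
  by rewrite Xx Xy => /eqP; rewrite (negbTE Mxy).
apply/eqP; rewrite eq_le pr_ge0 andbT.
rewrite (@le_trans _ _ (pr (setT `&` [set w | X n w = x] `&` [set w | X n.+1 w = y])))//.
  apply: pr_le => [||w [[_ ?] ?]//].
    by apply: measurableI => //; exact: measurableI.
  by apply: measurableI => //; exact: measurableI.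
by rewrite (past_next X_markov)// Mxy mulr0.
Qed.

(** For every [m] the event forces [m] consecutive states in T, whose probability is an average of
    [survival m] and tends to 0. *)
Lemma pr_stay n : pr [set w | forall k, X (n + k) w \in TV] = 0.
Proof.
apply/eqP; rewrite eq_le pr_ge0 andbT.
have h m : pr [set w | forall k, X (n + k) w \in TV] <=
    \sum_x pr [set w | X n w = x] * survival m x.
  apply: (@le_trans _ _ (pr (follow n (nseq m TV)))).
    apply: pr_le; [exact: measurable_stay|exact: (measurable_follow X_markov)|].
    by move=> w wT; apply/followP => k; rewrite size_nseq => km; rewrite nth_nseq km.
  rewrite (pr_sum_fibers P (measurable_state_eq n) (measurable_follow X_markov _ _)).
  apply: ler_sum => x _; rewrite -[X in _ <= pr X * _]setTI.
  by rewrite -(pr_follow X_markov)// setTI setIC.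
have : (fun m => \sum_x pr [set w | X n w = x] * survival m x) @ \oo --> (0 : R).
  rewrite [X in _ --> X](_ : _ = \sum_x pr [set w | X n w = x] * 0); last first.
    by rewrite big1// => x _; rewrite mulr0.
  apply: cvg_big => [|x _]; first exact: add_continuous.
  by apply: cvgM; [exact: cvg_cst|exact: survival_cvg0].
move=> s0; have <- := cvg_lim (@Rhausdorff R) s0.
by apply: limr_ge; [apply/cvg_ex; exists 0|exact: nearW].
Qed.

Lemma negligible_bad n : P.-negligible (bad n).
Proof.
have neg A : measurable A -> pr A = 0 -> P.-negligible A.
  by move=> mA A0; exists A; split => //; rewrite [LHS](prE P mA) A0.
apply: negligibleU; apply: neg.
- exact: measurable_forbidden.
- exact: pr_forbidden.
- exact: measurable_stay.
- exact: pr_stay.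
Qed.

Lemma measurable_all_bad : measurable (\bigcup_n bad n).
Proof. by apply: bigcupT_measurable => n; exact: measurable_bad. Qed.

Lemma all_bad_eq0 : P (\bigcup_n bad n) = 0%E.
Proof.
apply/eqP; rewrite measure_negligible//; first exact: measurable_all_bad.
exact/negligible_bigcup/negligible_bad.
Qed.

Definition good : set O := B `\` \bigcup_n bad n.

Lemma measurable_good : measurable good.
Proof. by apply: measurableD; [exact: measurable_state_in|exact: measurable_all_bad]. Qed.

Lemma pr_good E : measurable E -> pr (good `&` E) = pr (B `&` E).
Proof.
move=> mE; have mBE : measurable (B `&` E).
  by apply: measurableI => //; exact: measurable_state_in.
congr fine; rewrite [RHS](measureDI _ mBE measurable_all_bad)//.
rewrite [X in (_ + X)%E](@subset_measure0 _ _ _ P _ (\bigcup_n bad n)) ?adde0//.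
- by congr (P _); rewrite /good !setDE setIAC.
- by apply: measurableI => //; exact: measurable_all_bad.
- exact: measurable_all_bad.
- exact: all_bad_eq0.
Qed.

Section OnePath.
Variable w : O.
Hypothesis w_good : good w.
Local Notation tau m := (tau X m w).

Lemma good_step n : M (X n w) (X n.+1 w) != 0.
Proof.
by have [_ nb] := w_good; apply/eqP => M0; apply: nb; exists n => //; left.
Qed.

Lemma good_copies n : X n w \in CV -> X n.+1 w \in TV.
Proof.
move=> XC; have := good_step n; rewrite Mhat_copies//.
by apply: contraNT => XT; rewrite restart_eq0.
Qed.

Lemma good_state n : (X n w \in TV) || (X n w \in CV).
Proof.
elim: n => [|n /orP[XT|XC]]; first by have [-> _] := w_good.
  exact: Mhat_TV XT (good_step n).
by rewrite good_copies.
Qed.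

Lemma follow_sojournP t c : follow t (sojourn_pattern W c) w <->
  (forall j, (j < c)%N -> X (t + j) w \in TV) /\ X (t + c) w \in CV.
Proof.
rewrite follow_cat size_nseq /= followP size_nseq.
split => [[h [XC _]]|[h XC]]; split=> // j jc; have := h j jc; by rewrite nth_nseq jc.
Qed.

Lemma good_sojourn t : exists c, follow t (sojourn_pattern W c) w.
Proof.
have ex : exists c, X (t + c) w \in CV.
  have [_ nb] := w_good; apply: contrapT => /forallNP h; apply: nb.
  exists t => //; right => k /=.
  by have /orP[//|/h] := good_state (t + k).
case: (ex_minnP ex) => c XC cmin; exists c; apply/follow_sojournP; split => // j jc.
have /orP[//|XC'] := good_state (t + j).
by have := cmin j XC'; rewrite leqNgt jc.
Qed.

Lemma tau_next m t c : tau m = t%:R%:E -> follow t (sojourn_pattern W c) w ->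
  tau m.+1 = (t + c).+1%:R%:E /\ X (t + c).+1 w \in TV.
Proof.
move=> taum /follow_sojournP[XT XC]; have XT' := good_copies XC.
split => //=; apply: inf_time_min.
  by split => //; rewrite taum lte_fin ltr_nat ltnS leq_addr.
(* A competing time [n.+1] has a copy as predecessor, but the states at times [t] to [t + c - 1] lie
   in T, so [n] is at least [t + c]. *)
move=> [|n] [] /=; rewrite taum lte_fin ltr_nat// => tn _ XnC.
rewrite ltnS leqNgt; apply/negP => ntc.
have := XT (n - t)%N; rewrite subnKC// ltn_subLR// => /(_ ntc) /TV_CV.
by rewrite XnC.
Qed.

Lemma tau_nat m : exists t, tau m = t%:R%:E /\ X t w \in TV.
Proof.
elim: m => [|m [t [taum XT]]]; last first.
  by have [c /(tau_next taum)[? ?]] := good_sojourn t; exists (t + c).+1.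
have [XT _] := w_good; exists 0%N; split => //=.
exact: inf_time_min.
Qed.

Lemma sojourn_lengthE m t c : tau m = t%:R%:E ->
  follow t (sojourn_pattern W c) w -> sojourn_length X m w = c%:R%:E.
Proof.
move=> taum fc; have [taum1 _] := tau_next taum fc.
rewrite /sojourn_length taum1 taum -!EFinB; congr _%:E.
by rewrite -natr1 natrD; ring.
Qed.

Lemma sojourn_length_nat m : exists c : nat, sojourn_length X m w = c%:R%:E.
Proof.
have [t [taum _]] := tau_nat m; have [c fc] := good_sojourn t.
by exists c; exact: sojourn_lengthE taum fc.
Qed.

Lemma first_copy_time m :
  (tau m.+1 - 1 = inf_time [set n | (tau m < n%:R%:E) /\ X n w \in CV])%E /\
  (forall n : nat, (tau m <= n%:R%:E)%E ->
     (n%:R%:E <= tau m.+1 - 2%:R%:E)%E -> X n w \in TV).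
Proof.
have [t [taum Xt]] := tau_nat m; have [c fc] := good_sojourn t.
have [taum1 _] := tau_next taum fc; have /follow_sojournP[XT XC] := fc.
rewrite taum taum1; split => [|n].
  rewrite -EFinB -natr1 addrK; apply/esym/inf_time_min.
    (* [c] is positive, because the state at time [t] is in T; hence the copy comes strictly after
       [tau m]. *)
    split => //=; rewrite lte_fin ltr_nat; case: c {fc taum1 XT} XC => [|c _].
      by rewrite addn0 TV_CV.
    by rewrite addnS ltnS leq_addr.
  move=> k [] /=; rewrite lte_fin ltr_nat => /ltnW tk XkC.
  rewrite leqNgt; apply/negP => ktc.
  have := XT (k - t)%N; rewrite subnKC// ltn_subLR// => /(_ ktc) /TV_CV.
  by rewrite XkC.
rewrite lee_fin ler_nat => tn; rewrite -EFinB lee_fin lerBrDr -natrD ler_nat.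
rewrite addn2 ltnS => ntc; have := XT (n - t)%N.
by rewrite subnKC// ltn_subLR//; apply.
Qed.

(** Turns prescribed sojourn lengths into a pattern of visited sets, whose probability is known to
    factorize. *)
Lemma sojourn_patternP m t cs : tau m = t%:R%:E ->
  (forall i, (i < size cs)%N ->
     sojourn_length X (m + i) w = (nth 0%N cs i)%:R%:E) <->
  follow t (flatten (map (sojourn_pattern W) cs)) w.
Proof.
elim: cs m t => [|c cs IH] m t taum //=.
rewrite follow_cat size_cat size_nseq addn1 addnS.
split=> [h|[fc]].
  have [c' fc'] := good_sojourn t.
  have [taum1 _] := tau_next taum fc'.
  have := h 0%N isT; rewrite addn0 (sojourn_lengthE taum fc') => -[/eqP].
  rewrite eqr_nat => /eqP c'c; subst c'; split => //; apply/(IH m.+1 _ taum1).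
  by move=> i ics; rewrite addSnnS; exact: (h i.+1).
have [taum1 _] := tau_next taum fc => /(IH _ _ taum1) h [_|i]; last first.
  by rewrite ltnS addnS -addSn => /h.
by rewrite addn0 /=; exact: sojourn_lengthE fc.
Qed.

End OnePath.

End GoodPaths.

(** * The sequence of sojourn lengths *)

Section SojournSequence.
Context {R : realType} {N : nat} (W : 'M[R]_N).
Hypothesis W_ge0 : forall i j, 0 <= W i j.
Context {d} {O : measurableType d} (P : probability O R) (X : nat -> O -> Vhat W).
Hypothesis X_markov : markov_chain P X (@varpi R N W) (@Mhat R N W).
Local Notation T := (Tset W).
Local Notation TV := (T_in_Vhat W).
Local Notation CV := (copies W).
Local Notation pr := (pr P).
Local Notation good := (good X).
Local Notation law := (law W).
Local Notation lawE := (lawE W).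
Local Notation Y := (sojourn_length X).
Hypothesis T0 : T != finset.set0.

Let B := [set w | X 0%N w \in TV].

Lemma measurable_fun_inf_time (A : O -> set nat) :
  (forall n, measurable [set w | A w n]) ->
  measurable_fun setT (fun w => inf_time (A w) : \bar R).
Proof.
move=> mA; under eq_fun do rewrite inf_time_einfs.
apply: (measurable_fun_einfs (f := fun n w => if n \in A w then n%:R%:E else +oo%E)).
move=> n; apply: measurable_fun_ifT; try exact: measurable_cst.
apply: (measurable_fun_bool true); rewrite setTI.
rewrite (_ : _ @^-1` _ = [set w | A w n])//.
by apply/seteqP; split => w; [move/set_mem|move/mem_set].
Qed.

Lemma measurable_tau m : measurable_fun setT (tau X m : O -> \bar R).
Proof.
elim: m => [|m IH] /=; apply: measurable_fun_inf_time => n.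
  exact: (measurable_state_in X_markov).
rewrite (_ : mkset _ = [set w | (tau X m w < n%:R%:E)%E] `&`
    ([set w | X n w \in TV] `&` [set w | X n.-1 w \in CV])).
  apply: measurableI; last by apply: measurableI; exact: (measurable_state_in X_markov).
  by rewrite -[X in measurable X]setTI; exact: emeasurable_fun_infty_o.
by apply/seteqP; split => [w [? ? ?]|w [? [? ?]]].
Qed.

Lemma measurable_sojourn_length m : measurable_fun setT (Y m).
Proof.
apply: emeasurable_funB; last exact: measurable_cst.
by apply: emeasurable_funB; exact: measurable_tau.
Qed.

Lemma measurable_sojourn_in m (A : set (\bar R)) :
  measurable A -> measurable (Y m @^-1` A).
Proof.
by move=> mA; rewrite -[X in measurable X]setTI; exact: measurable_sojourn_length.
Qed.

Definition prefix_is (cs : seq nat) : set O :=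
  \bigcap_(i in [set i | (i < size cs)%N]) Y i @^-1` [set (nth 0%N cs i)%:R%:E].

Definition range_in (A : nat -> set (\bar R)) (k r : nat) : set O :=
  \bigcap_(i in [set i | (k <= i < k + r)%N]) Y i @^-1` A i.

Lemma measurable_prefix cs : measurable (prefix_is cs).
Proof.
apply: bigcap_measurableType => i _; apply: measurable_sojourn_in.
exact: emeasurable_set1.
Qed.

Lemma measurable_range A k r : (forall i, measurable (A i)) ->
  measurable (range_in A k r).
Proof. by move=> mA; apply: bigcap_measurableType => i _; exact: measurable_sojourn_in. Qed.

Lemma tau0 w : good w -> tau X 0 w = 0%:R%:E.
Proof. by move=> [Xw _]; apply: inf_time_min. Qed.

Lemma pr_prefix cs : pr (good `&` prefix_is cs) = pr B * \prod_(c <- cs) law c.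
Proof.
rewrite -(law_pattern W_ge0 T0) -(pr_B_follow X_markov)//.
rewrite -(pr_good W_ge0 X_markov)//; last exact: (measurable_follow X_markov).
congr pr; apply/seteqP; split => w [gw h]; split => //; last first.
  move=> i; move: h; rewrite -(sojourn_patternP gw (m := 0) cs (tau0 gw)) => h.
  exact: h.
by rewrite -(sojourn_patternP gw (m := 0) cs (tau0 gw)) => i; exact: h.
Qed.

(* Summing the joint law over the value of the k-th sojourn length, from the
   last coordinate to the first. *)
Lemma pr_prefix_range (A : nat -> set (\bar R)) cs r :
  (forall i, measurable (A i)) ->
  pr (good `&` (prefix_is cs `&` range_in A (size cs) r)) =
  pr B * \prod_(c <- cs) law c *
    \prod_(size cs <= i < size cs + r) fine (lawE (A i)).
Proof.
move=> mA; have mgood := measurable_good X_markov.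
elim: r cs => [|r IH] cs.
  rewrite addn0 big_geq// mulr1 -pr_prefix; congr pr.
  rewrite (_ : range_in _ _ _ = setT) ?setIT//.
  apply/seteqP; split => // w _ i /=; rewrite addn0 => /andP[/leq_ltn_trans h /h].
  by rewrite ltnn.
have mE cs' k r' : measurable (good `&` (prefix_is cs' `&` range_in A k r')).
  by apply: measurableI => //; apply: measurableI;
    [exact: measurable_prefix|exact: measurable_range].
apply: EFin_inj; rewrite -prE//.
set k := size cs.
(* On a good path the [k]-th length is a natural number, so its value splits the event into
   countably many disjoint pieces. *)
have -> : good `&` (prefix_is cs `&` range_in A k r.+1) =
    \bigcup_(c in [set c : nat | A k c%:R%:E])
      (good `&` (prefix_is (rcons cs c) `&` range_in A k.+1 r)).
  apply/seteqP; split => [w [gw [pw rw]]|w [c /= Akc [gw [pw rw]]]].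
    have [c Yc] := sojourn_length_nat gw k.
    exists c; first by rewrite /= -Yc; apply: rw; rewrite /= leqnn addnS ltnS leq_addr.
    split => //; split => i /=.
      rewrite size_rcons ltnS leq_eqVlt nth_rcons => /predU1P[->|ics].
        by rewrite ltnn eqxx.
      by rewrite ics; exact: pw.
    by rewrite addSnnS => /andP[/ltnW ki ikr]; apply: rw; rewrite /= ki.
  have Yk : Y k w = c%:R%:E.
    by have := pw k; rewrite /= size_rcons nth_rcons ltnn eqxx; exact.
  split => //; split => i /=.
    move=> ics; have := pw i; rewrite /= size_rcons nth_rcons ics ltnS; apply.
    exact: ltnW.
  rewrite leq_eqVlt => /andP[/predU1P[<-|ki] ikr]; first by rewrite Yk.
  by apply: rw; rewrite /= ki addSnnS.
rewrite measure_bigcup//; last first.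
  move=> c c' _ _ [w [[_ [pw _]] [_ [pw' _]]]].
  have := pw k; have := pw' k; rewrite /= !size_rcons !nth_rcons !ltnn !eqxx.
  by move=> -> // /(_ (ltnSn _)) [/eqP]; rewrite eqr_nat => /eqP.
rewrite big_ltn; last by rewrite addnS ltnS leq_addr.
set G := \prod_(k.+1 <= i < _) _.
rewrite [_ * (fine _ * G)]mulrCA mulrC [RHS]EFinM -lawE_fin//.
rewrite /lawE -nneseriesZl => [|c _]; last by rewrite lee_fin law_ge0.
apply: eq_eseriesr => c _; rewrite [LHS]prE//.
have := IH (rcons cs c); rewrite size_rcons => ->.
rewrite addSnnS -/G -cats1 big_cat big_seq1 /=.
by rewrite -EFinM; congr _%:E; ring.
Qed.

(** [J] is completed to an initial segment of indices by imposing [setT] at the missing ones; each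
    of these contributes a factor [lawE setT = 1]. *)
Lemma pr_sojourn_in (J : seq nat) (A : nat -> set (\bar R)) :
  uniq J -> (forall m, measurable (A m)) ->
  pr (good `&` [set w | forall m, m \in J -> A m (Y m w)]) =
  pr B * \prod_(m <- J) fine (lawE (A m)).
Proof.
move=> uJ mA; pose n := (\max_(m <- J) m).+1.
have Jn m : m \in J -> (m < n)%N by move=> mJ; rewrite ltnS leq_bigmax_seq.
pose A' m := if m \in J then A m else setT.
have mA' m : measurable (A' m) by rewrite /A'; case: ifP.
have := @pr_prefix_range A' [::] n mA'; rewrite big_nil mulr1 add0n => E.
transitivity (pr B * \prod_(0 <= i < n) fine (lawE (A' i))).
  rewrite -E; congr pr; congr (_ `&` _); apply/seteqP; split => [w h|w [_ h] m mJ].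
    split => [i//|i /= _]; rewrite /A'; case: ifPn => // iJ; exact: h.
  by have := h m (Jn m mJ); rewrite /A' /= mJ.
congr (_ * _); transitivity (\prod_(0 <= i < n | i \in J) fine (lawE (A i))).
  rewrite [RHS]big_mkcond; apply: eq_bigr => i _; rewrite /A'.
  by case: ifP => // _; rewrite lawE_setT.
rewrite -big_filter; apply: perm_big; apply: uniq_perm => //.
  by rewrite filter_uniq// iota_uniq.
move=> i; rewrite mem_filter mem_index_iota /=.
by apply/andP/idP => [[]//|iJ]; rewrite iJ Jn.
Qed.

Lemma cprob_sojourn (E : set O) : measurable E ->
  cprob P E B = pr (good `&` E) / pr B.
Proof. by move=> mE; rewrite (pr_good W_ge0 X_markov)// setIC. Qed.

Lemma cprob_sojourn_in m (A : set (\bar R)) : measurable A ->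
  cprob P (Y m @^-1` A) B = fine (lawE A).
Proof.
move=> mA; have B0 : pr B != 0 by rewrite gt_eqF// (pr_B_gt0 X_markov).
rewrite cprob_sojourn; last exact: measurable_sojourn_in.
have := @pr_sojourn_in [:: m] (fun=> A) isT (fun=> mA).
rewrite big_seq1 (_ : [set w | _] = Y m @^-1` A) => [->|].
  by rewrite mulrC mulKf.
apply/seteqP; split => [w h|w h k]; first exact/h/mem_head.
by rewrite inE => /eqP ->.
Qed.

Lemma sojourn_length_iid : iid_given P B Y.
Proof.
have B0 : pr B != 0 by rewrite gt_eqF// (pr_B_gt0 X_markov).
split => [m|J A uJ mA|m A mA].
- exact/measurable_funTS/measurable_sojourn_length.
- rewrite cprob_sojourn.
    rewrite pr_sojourn_in// mulrC mulKf//.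
    by apply: eq_bigr => m _; rewrite cprob_sojourn_in.
  rewrite (_ : [set w | _] = \bigcap_(m in [set m | m \in J]) Y m @^-1` A m)//.
  by apply: bigcap_measurableType => m _; exact: measurable_sojourn_in.
- by rewrite !cprob_sojourn_in.
Qed.

Lemma ae_good : {ae P, forall w, B w -> good w}.
Proof.
exists (\bigcup_n bad X n); split.
- by apply: bigcupT_measurable => n; exact: (measurable_bad X_markov).
- by apply: all_bad_eq0 => //.
- by move=> w /= h; apply: contrapT => nb; apply: h.
Qed.

(** The tail-sum formula: the mean is the sum over [n] of the probabilities that the length exceeds
    [n], that is of [tail W n.+1]. *)
Lemma sojourn_length_mean m : cexp P (Y m) B = ((theta_T W)^-1)%:E.
Proof.
have mB : measurable B by exact: (measurable_state_in X_markov).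
have B0 : pr B != 0 by rewrite gt_eqF// (pr_B_gt0 X_markov).
pose E n := good `&` [set w | (n%:R%:E < Y m w)%E].
have mgt n : measurable [set y : \bar R | (n%:R%:E < y)%E].
  rewrite (_ : mkset _ = [set` `]n%:R%:E, +oo%E]]); first exact: emeasurable_itv.
  by apply/seteqP; split => y /=; rewrite in_itv/= leey andbT.
have mE n : measurable (E n).
  apply: measurableI; first exact: (measurable_good X_markov).
  exact: (@measurable_sojourn_in m [set y | (n%:R%:E < y)%E] (mgt n)).
have prEn n : P (E n) = (pr B * tail W n.+1)%:E.
  rewrite prE//; congr _%:E.
  have := @pr_sojourn_in [:: m] (fun=> [set y | (n%:R%:E < y)%E]) isT (fun=> mgt n).
  rewrite big_seq1 lawE_gt// => <-; congr pr; congr (_ `&` _).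
  apply/seteqP; split => [w Yn i|w h]; first by rewrite inE => /eqP ->.
  exact/h/mem_head.
(* On a good path of length [c], exactly the indicators with [n < c] equal 1. *)
have YE : ae_eq P B (Y m) (fun w => \sum_(0 <= n <oo) (\1_(E n) w)%:E)%E.
  have := ae_good; apply: filterS => w Bg Bw.
  have gw := Bg Bw; have [c Yc] := sojourn_length_nat gw m.
  rewrite Yc; apply/esym.
  rewrite (nneseries_split 0 c) => [|k _]; last by rewrite lee_fin.
  rewrite add0n eseries0 ?adde0 => [|k ck _]; last first.
    rewrite indicE memNset// => -[_ /=]; rewrite Yc lte_fin ltr_nat.
    by rewrite ltnNge ck.
  rewrite (eq_big_nat _ _ (F2 := fun=> 1%E)) => [|k /andP[_ kc]].
    by rewrite sumEFin big_const_nat subn0 iter_addr addr0.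
  by rewrite indicE mem_set//; split => //=; rewrite Yc lte_fin ltr_nat.
have -> : cexp P (Y m) B = ((pr B)^-1%:E *
    \int[P]_(w in B) (\sum_(0 <= n <oo) (\1_(E n) w)%:E))%E.
  congr (_ * _)%E; apply: ae_eq_integral => //.
    exact/measurable_funTS/measurable_sojourn_length.
  apply: ge0_emeasurable_sum => n; first by move=> *; rewrite lee_fin.
  by move=> _; apply/measurable_EFinP; exact: measurable_indic.
rewrite integral_nneseries//; last first.
  by move=> n; apply/measurable_EFinP; exact: measurable_indic.
rewrite (eq_eseriesr (g := fun n => ((pr B)%:E * (tail W n.+1)%:E)%E)); last first.
  move=> n _.
  rewrite integral_indic// setIidl; first by rewrite [LHS]prEn EFinM.
  by move=> w [[]].
rewrite nneseriesZl => [|n _]; last first.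
  rewrite lee_fin; apply: sumr_ge0 => x _.
  by rewrite mulr_ge0 ?restart_ge0 ?follow_prob_ge0.
rewrite muleA -EFinM mulVf// mul1e theta_T_mean// invrK.
apply/cvg_lim => //; under eq_fun do rewrite sumEFin.
by apply: cvg_EFin; [exact: nearW|exact: tail_sum_cvg].
Qed.

End SojournSequence.

Theorem theorem3p2 (R : realType) (N : nat) (W : 'M[R]_N)
    (W_ge0 : forall i j, 0 <= W i j)
    (d : measure_display) (O : measurableType d) (P : probability O R)
    (X : nat -> O -> Vhat W)
    (X_markov : markov_chain P X (@varpi R N W) (@Mhat R N W)) :
  (* (i) *)
  ((forall j : 'I_N, j \in Tset W ->
      (fun n : nat => (n%:R^-1)%:E *
         \sum_(i : Vhat W) (varpi i)%:E *
           cexp P (fun w => (\sum_(0 <= nu < n)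
                               \1_[set w' | X nu w' = node W j] w)%:E)
                  [set w | X 0%N w = i])%E @ \oo
        --> (PureRank W j)%:E)
   /\
   (forall j : 'I_N, j \in Rset W :|: Dset W ->
      (fun n : nat => (n%:R^-1)%:E *
         \sum_(i : Vhat W) (varpi i)%:E *
           cexp P (fun w => (\sum_(0 <= nu < n)
                               \1_[set w' | X nu w' \in node_pair W j] w)%:E)
                  [set w | X 0%N w = i])%E @ \oo
        --> (PureRank W j)%:E))
  /\
  (* (ii) *)
  (Tset W != finset.set0 ->
   let B := [set w | X 0%N w \in T_in_Vhat W] in
   [/\ (* tau (m+1) - 1 is the first hitting time of the copies after tau m,
          and X stays in T from time tau m to time tau (m+1) - 2 *)
       {ae P, forall w, B w -> forall m : nat,
          (tau X m.+1 w - 1 =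
             inf_time [set n | (tau X m w < n%:R%:E) /\ X n w \in copies W])%E
          /\ (forall n : nat, (tau X m w <= n%:R%:E)%E ->
               (n%:R%:E <= tau X m.+1 w - 2%:R%:E)%E -> X n w \in T_in_Vhat W)},
       iid_given P B (sojourn_length X),
       forall m : nat, cexp P (sojourn_length X m) B = ((theta_T W)^-1)%:E,
       (theta_T W)^-1 = (#|Tset W|%:R * beta_T W)^-1
     & (#|Tset W|%:R * beta_T W)^-1 =
         (unif (Tset W) *m fundT W *m ones (Tset W)) 0 0]).
Proof.
split; [split => j jT|move=> T0].
(* A node of T has no copy, so its pair reduces to the node and the general convergence applies. *)
- have E : (fun nu => [set w | X nu w = node W j]) =
           (fun nu => [set w | X nu w \in node_pair W j]).
    apply/funext => nu; apply/seteqP; split => w /=.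
      by move=> ->; rewrite inE eqxx.
    rewrite inE => /orP[/eqP Xj|/eqP Xj]; first exact/val_inj.
    have /= := valP (X nu w); rewrite Xj /= setC_Tset.
    by rewrite jT andbF.
  (* Exposes the sequence as a function of the events, so that [E] can be rewritten below the
     binders. *)
  pose F (A : nat -> set O) (n : nat) : \bar R := ((n%:R^-1)%:E *
    \sum_(i : Vhat W) (varpi i)%:E *
      cexp P (fun w => (\sum_(0 <= nu < n) \1_(A nu) w)%:E)
        [set w | X 0%N w = i])%E.
  rewrite -[X in X @ _]/(F (fun nu => [set w | X nu w = node W j])) E.
  exact: PureRank_cvg.
- exact: PureRank_cvg.
split.
- have := ae_good W_ge0 X_markov T0; apply: filterS => w Bg Bw m.
  exact: first_copy_time (Bg Bw) m.
- exact: sojourn_length_iid.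
- exact: sojourn_length_mean.
- by rewrite theta_T_mean// invrK mean_sojourn_beta.
- by rewrite mean_sojourn_beta.
Qed.
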